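(* Let $\mathcal{S}$ be a weakly approximable triangulated category with a compact generator $G$ such that $\mathrm{Hom}_{\mathcal{S}}(G,G[i])=0$ for $i\ll 0$. Then $$\mathrm{findim}(\mathcal{S}^c,G)\le \mathrm{fpd}(\mathcal{S},G)+a(G)\quad\text{and}\quad \mathrm{fpd}(\mathcal{S},G)\le\mathrm{findim}(\mathcal{S}^c,G)+o^+(G).$$ In particular, $\mathrm{findim}(\mathcal{S}^c,G)$ is finite if and only if so is $\mathrm{fpd}(\mathcal{S},G)$.
   Context: Let $\mathcal{S}$ be a triangulated category with coproducts, $\mathcal{S}^c$ its full subcategory of compact objects. For $A\le B$ in $\mathbb{Z}\cup\{\pm\infty\}$, $G[A,B]=\{G[-i]\mid i\in\mathbb{Z},A\le i\le B\}$; $\mathrm{Coprod}(\mathcal{A})$ is the smallest full subcategory containing $\mathcal{A}$ closed under coproducts and extensions; $\overline{\langle G\rangle}^{[A,B]}$ consists of all direct summands of objects of $\mathrm{Coprod}(G[A,B])$; $\langle G\rangle^{[A,B]}$ is the smallest full subcategory containing $G[A,B]$ closed under extensions, finite direct sums and direct summands. $G$ is a compact generator if $G\in\mathcal{S}^c$ and $\mathcal{S}=\overline{\langle G\rangle}^{(-\infty,+\infty)}$. For a $t$-structure $(\mathcal{S}^{\le 0},\mathcal{S}^{\ge 1})$: $\mathcal{S}^{\le n}=\mathcal{S}^{\le 0}[-n]$, $\mathcal{S}^{\ge n+1}=\mathcal{S}^{\ge 1}[-n]$. $\mathcal{S}$ is weakly approximable if it has a compact generator $G$, a $t$-structure and an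 integer $A>0$ such that $G[A]\in\mathcal{S}^{\le 0}$, $\mathrm{Hom}_{\mathcal{S}}(G[-A],\mathcal{S}^{\le 0})=0$, and each $F\in\mathcal{S}^{\le 0}$ admits a triangle $E\to F\to D\to E[1]$ with $E\in\overline{\langle G\rangle}^{[-A,A]}$ and $D\in\mathcal{S}^{\le -1}$. (This is independent of the choice of $G$; and the $t$-structure may be taken to be the one generated by $G$.) Given the compact generator $G$, equip $\mathcal{S}$ with the $t$-structure generated by $G$: $\mathcal{S}^{\le 0}=\mathrm{Coprod}(G(-\infty,0])$, $\mathcal{S}^{\ge 1}=\{X\mid\mathrm{Hom}_{\mathcal{S}}(G[i],X)=0\ \forall i\ge 0\}$. $\mathcal{S}^b$ is the full subcategory of objects $X$ with $X[n]\in\mathcal{S}^{\le 0}$ and $X[-n]\in\mathcal{S}^{\ge 1}$ for some $n\geq 0$. - $\mathrm{findim}(\mathcal{S}^c,G)=\inf\{n\in\mathbb{N}\mid \{X\in\mathcal{S}^c\mid\mathrm{Hom}(G[m],X)=0\ \forall m\ge1\}\subseteq\langle G\rangle^{[0,+\infty)}[n]\}$. - $\mathrm{pd}_G(X)=\inf\{n\in\mathbb{Z}\mid\mathrm{Hom}_{\mathcal{S}}(X,Y[i])=0\ \forall i>n,\ Y\in\mathcal{S}^b\cap\mathcal{S}^{\le 0}\}$. - $\mathrm{fpd}(\mathcal{S},G)=\sup\{\mathrm{pd}_G(X)\mid X\in\mathcal{S}^c\cap\mathcal{S}^b\cap\mathcal{S}^{\ge 0},\ \mathrm{pd}_G(X)<+\infty\}$.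 - $o^+(G)=\inf\{c\ge 0\mid\mathrm{Hom}_{\mathcal{S}}(G,G[i])=0\ \forall i>c\}$. - $G$-approximable index: $a(G)=\sup\{b(M)\mid M\in\mathcal{S}^{\le 0}\}$, where $b(M)=\inf\{n\ge0\mid\exists$ a triangle $E\to M\to D\to E[1]$ with $E\in\overline{\langle G\rangle}^{[-n,n]}$, $D\in\mathcal{S}^{\le -1}\}$; it is finite.
   Formalization: The first inequality is proved as findim ≤ max(0, fpd + a(G)): findim is an infimum over ℕ while fpd + a(G) can be negative (e.g. S = 0, or G = k[x]/(x²) with |x| = −1, where findim = 0, fpd = −1, a = 0), so the literal inequality fails there. *)

(* Defs.v *)
From mathcomp Require Import all_boot all_order all_algebra.
From mathcomp Require Import all_classical constructive_ereal.

Set Implicit Arguments.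
Unset Strict Implicit.
Unset Printing Implicit Defensive.

Import Order.TTheory GRing.Theory Num.Theory.

Local Open Scope classical_set_scope.
Local Open Scope ring_scope.

Reserved Notation "g \oc f" (at level 40, left associativity).

(* [comp g f] (notation [g \oc f]) is "g after f". *)
Structure preadditiveCategory := PreadditiveCategory {
  obj :> Type;
  hom : obj -> obj -> zmodType;
  idm : forall X, hom X X;
  comp : forall X Y Z, hom Y Z -> hom X Y -> hom X Z;
  comp1m : forall X Y (f : hom X Y), comp (idm Y) f = f;
  compm1 : forall X Y (f : hom X Y), comp f (idm X) = f;
  compA : forall X Y Z W (h : hom Z W) (g : hom Y Z) (f : hom X Y),
    comp h (comp g f) = comp (comp h g) f;
  compDl : forall X Y Z (g g' : hom Y Z) (f : hom X Y),
    comp (g + g') f = comp g f + comp g' f;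
  compDr : forall X Y Z (g : hom Y Z) (f f' : hom X Y),
    comp g (f + f') = comp g f + comp g f'
}.

Arguments idm {_} _.
Notation "g \oc f" := (comp g f) : ring_scope.

(* These two definitions only fix universe levels: small index sets (the
   choiceTypes below) are no larger than the sets underlying hom-groups, whereas
   the objects may form a proper class. Were the objects of a category with
   small coproducts a small set, the category would be trivial. *)
Definition small_index_level (I : choiceType) : zmodType := (I -> int : zmodType).
Definition large_objects_level : Type@{preadditiveCategory.u0} := zmodType.

Definition is_iso (C : preadditiveCategory) (X Y : C) (f : hom X Y) : Prop :=
  exists g : hom Y X, g \oc f = idm X /\ f \oc g = idm Y.

Definition isomorphic (C : preadditiveCategory) (X Y : C) : Prop :=
  exists f : hom X Y, is_iso f.

Definition is_zero_object (C : preadditiveCategory) (Z : C) : Prop :=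
  forall X : C, (forall f : hom X Z, f = 0) /\ (forall f : hom Z X, f = 0).

Definition is_biproduct (C : preadditiveCategory) (X Y P : C) : Prop :=
  exists (i1 : hom X P) (i2 : hom Y P) (p1 : hom P X) (p2 : hom P Y),
    [/\ p1 \oc i1 = idm X, p2 \oc i2 = idm Y, p1 \oc i2 = 0, p2 \oc i1 = 0
      & i1 \oc p1 + i2 \oc p2 = idm P].

Definition is_additive (C : preadditiveCategory) : Prop :=
  (exists Z : C, is_zero_object Z) /\
  (forall X Y : C, exists P : C, is_biproduct X Y P).

Structure additiveEndofunctor (C : preadditiveCategory) := AdditiveEndofunctor {
  fobj :> C -> C;
  fmap : forall X Y, hom X Y -> hom (fobj X) (fobj Y);
  fmap1 : forall X, fmap (idm X) = idm (fobj X);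
  fmap_comp : forall X Y Z (g : hom Y Z) (f : hom X Y),
    fmap (g \oc f) = fmap g \oc fmap f;
  fmapD : forall X Y (f g : hom X Y), fmap (f + g) = fmap f + fmap g
}.

Arguments fmap {_} _ {_ _} _.

(* The suspension [susp] = [1] is an autoequivalence with a chosen
   quasi-inverse [desusp] = [-1]; a strict automorphism is a special case. *)
Structure triangulatedCategory := TriangulatedCategory {
  tcat :> preadditiveCategory;
  tcat_additive : is_additive tcat;
  susp : additiveEndofunctor tcat;
  desusp : additiveEndofunctor tcat;
  susp_unit : forall X, hom X (desusp (susp X));
  susp_unit_iso : forall X, is_iso (susp_unit X);
  susp_unit_nat : forall X Y (f : hom X Y),
    susp_unit Y \oc f = fmap desusp (fmap susp f) \oc susp_unit X;
  susp_counit : forall X, hom (susp (desusp X)) X;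
  susp_counit_iso : forall X, is_iso (susp_counit X);
  susp_counit_nat : forall X Y (f : hom X Y),
    susp_counit Y \oc fmap susp (fmap desusp f) = f \oc susp_counit X;
  dist : forall X Y Z : tcat,
    hom X Y -> hom Y Z -> hom Z (susp X) -> Prop;
  (* TR1 *)
  dist_iso : forall X Y Z X' Y' Z' (f : hom X Y) (g : hom Y Z)
      (h : hom Z (susp X)) (f' : hom X' Y') (g' : hom Y' Z')
      (h' : hom Z' (susp X')) (a : hom X X') (b : hom Y Y') (c : hom Z Z'),
    is_iso a -> is_iso b -> is_iso c ->
    b \oc f = f' \oc a -> c \oc g = g' \oc b ->
    fmap susp a \oc h = h' \oc c ->
    dist f g h -> dist f' g' h';
  dist_id : forall X Z : tcat, is_zero_object Z ->
    dist (idm X) (0 : hom X Z) (0 : hom Z (susp X));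
  dist_cone : forall X Y (f : hom X Y),
    exists (Z : tcat) (g : hom Y Z) (h : hom Z (susp X)), dist f g h;
  (* TR2 *)
  dist_rot : forall X Y Z (f : hom X Y) (g : hom Y Z) (h : hom Z (susp X)),
    dist f g h <-> dist g h (- fmap susp f);
  (* TR3 *)
  dist_fill : forall X Y Z X' Y' Z' (f : hom X Y) (g : hom Y Z)
      (h : hom Z (susp X)) (f' : hom X' Y') (g' : hom Y' Z')
      (h' : hom Z' (susp X')) (a : hom X X') (b : hom Y Y'),
    dist f g h -> dist f' g' h' -> b \oc f = f' \oc a ->
    exists c : hom Z Z',
      c \oc g = g' \oc b /\ fmap susp a \oc h = h' \oc c;
  (* TR4, the octahedral axiom *)
  dist_oct : forall X Y Z A B C (f : hom X Y) (g : hom Y Z)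
      (u : hom Y A) (u' : hom A (susp X)) (v : hom Z B) (v' : hom B (susp Y))
      (w : hom Z C) (w' : hom C (susp X)),
    dist f u u' -> dist g v v' -> dist (g \oc f) w w' ->
    exists (a : hom A C) (b : hom C B),
      [/\ dist a b (fmap susp u \oc v'),
          a \oc u = w \oc g, w' \oc a = u',
          b \oc w = v & v' \oc b = fmap susp f \oc w']
}.

Arguments susp {_}.
Arguments desusp {_}.

Section Triangulated.
Variable S : triangulatedCategory.

(* [shift X n] is X[n]. *)
Definition shift (X : S) (n : int) : S :=
  match n with
  | Posz m => iter m susp X
  | Negz m => iter m.+1 desusp X
  end.

(* Small index sets are the choiceTypes: classically every type carries such a
   structure, and the hom-groups, being zmodTypes, are among them. *)
Definition is_coproduct (I : choiceType) (F : I -> S) (X : S)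
    (inj : forall i, hom (F i) X) : Prop :=
  forall (Y : S) (g : forall i, hom (F i) Y),
    exists! h : hom X Y, forall i, h \oc inj i = g i.

Definition has_coproducts : Prop :=
  forall (I : choiceType) (F : I -> S),
    exists (X : S) (inj : forall i, hom (F i) X), is_coproduct inj.

(* The canonical map from the direct sum of the groups Hom(X, F i), i.e. the
   finitely supported families, to Hom(X, coproduct of F) is bijective. *)
Definition is_compact (X : S) : Prop :=
  forall (I : choiceType) (F : I -> S) (Y : S) (inj : forall i, hom (F i) Y),
    is_coproduct inj ->
    forall h : hom X Y, exists! g : forall i, hom X (F i),
      finite_set [set i | g i != 0] /\
      h = \sum_(i \in [set: I]) (inj i \oc g i).

Definition is_summand (Y X : S) : Prop := exists Z : S, is_biproduct Y Z X.

Definition hom_zero (X Y : S) : Prop := forall f : hom X Y, f = 0.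

(* Full subcategories are predicates [S -> Prop] and not [set S], which would
   put the type of objects in the universe of choiceTypes. [shift_class P n] is
   P[n], closed under isomorphism. *)
Definition shift_class (P : S -> Prop) (n : int) : S -> Prop :=
  fun X => exists2 Y, P Y & isomorphic X (shift Y n).

(* G[A,B] *)
Definition shifts (G : S) (A B : \bar int) : S -> Prop :=
  fun X => exists i : int, (A <= i%:E <= B)%E /\ X = shift G (- i).

Inductive Coprod (P : S -> Prop) : S -> Prop :=
| Coprod_base X : P X -> Coprod P X
| Coprod_coprod (I : choiceType) (F : I -> S) X (inj : forall i, hom (F i) X) :
    (forall i, Coprod P (F i)) -> is_coproduct inj -> Coprod P X
| Coprod_ext X Y Z (f : hom X Y) (g : hom Y Z) (h : hom Z (susp X)) :
    dist f g h -> Coprod P X -> Coprod P Z -> Coprod P Y.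

Definition big_gen (G : S) (A B : \bar int) : S -> Prop :=
  fun X => exists2 Y, Coprod (shifts G A B) Y & is_summand X Y.

Inductive small_closure (P : S -> Prop) : S -> Prop :=
| small_base X : P X -> small_closure P X
| small_zero X : is_zero_object X -> small_closure P X
| small_sum X Y Z : is_biproduct X Y Z ->
    small_closure P X -> small_closure P Y -> small_closure P Z
| small_ext X Y Z (f : hom X Y) (g : hom Y Z) (h : hom Z (susp X)) :
    dist f g h -> small_closure P X -> small_closure P Z -> small_closure P Y
| small_summand X Y : is_summand X Y -> small_closure P Y -> small_closure P X.

Definition small_gen (G : S) (A B : \bar int) : S -> Prop :=
  small_closure (shifts G A B).

Definition compact_generator (G : S) : Prop :=
  is_compact G /\ forall X, big_gen G -oo%E +oo%E X.

Definition iso_closed (P : S -> Prop) : Prop :=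
  forall X Y, isomorphic X Y -> P X -> P Y.

Definition is_tstructure (le0 ge1 : S -> Prop) : Prop :=
  [/\ iso_closed le0 /\ iso_closed ge1,
      forall X, le0 X -> le0 (susp X),
      forall X, ge1 X -> ge1 (desusp X),
      forall X Y, le0 X -> ge1 Y -> hom_zero X Y
    & forall X, exists (U V : S) (f : hom U X) (g : hom X V)
                  (h : hom V (susp U)), [/\ dist f g h, le0 U & ge1 V]].

(* There is a triangle E -> M -> D -> E[1] with E in [P] and D in [Q]. *)
Definition approximated (P Q : S -> Prop) (M : S) : Prop :=
  exists (E D : S) (f : hom E M) (g : hom M D) (h : hom D (susp E)),
    [/\ dist f g h, P E & Q D].

Definition weakly_approximable : Prop :=
  exists (G : S) (le0 ge1 : S -> Prop) (A : int),
    [/\ compact_generator G, is_tstructure le0 ge1, 0 < A, le0 (shift G A)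
      & (forall X, le0 X -> hom_zero (shift G (- A)) X) /\
        (forall F, le0 F ->
          approximated (big_gen G (- A)%:E A%:E) (shift_class le0 1) F)].

Section Dimensions.
Variable G : S.

Definition gen_le0 : S -> Prop := Coprod (shifts G -oo%E 0%:E).

Definition gen_ge1 : S -> Prop :=
  fun X => forall i : int, 0 <= i -> hom_zero (shift G i) X.

Definition gen_le (n : int) : S -> Prop := shift_class gen_le0 (- n).
Definition gen_ge (n : int) : S -> Prop := shift_class gen_ge1 (1 - n).

Definition gen_bounded : S -> Prop :=
  fun X => exists n : nat, gen_le0 (shift X n%:Z) /\ gen_ge1 (shift X (- n%:Z)).

(* All infima and suprema are taken in the complete chain [\bar int]; the first
   argument of [infimum] / [supremum] is the value on the empty set. Thus
   [findim] is at least 0 by definition, while [fpd] can be negative: for the dg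
   algebra G = k[x]/(x^2) with x in degree -1 and zero differential, findim = 0,
   fpd = -1 and approx_index = 0; for S = 0, fpd = -oo. *)
Definition findim : \bar int :=
  infimum +oo%E [set (n%:Z)%:E | n in [set n : nat |
    forall X, is_compact X -> (forall m : int, 1 <= m -> hom_zero (shift G m) X) ->
      shift_class (small_gen G 0%:E +oo%E) n%:Z X]].

Definition pd (X : S) : \bar int :=
  infimum +oo%E [set n%:E | n in [set n : int |
    forall (i : int) (Y : S), n < i -> gen_bounded Y -> gen_le0 Y ->
      hom_zero X (shift Y i)]].

Definition fpd : \bar int :=
  supremum -oo%E [set x | exists X,
    [/\ is_compact X, gen_bounded X, gen_ge 0 X & (pd X < +oo)%E] /\ x = pd X].

Definition oplus_bound : \bar int :=
  infimum +oo%E [set (c%:Z)%:E | c in [set c : nat |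
    forall i : int, c%:Z < i -> hom_zero G (shift G i)]].

Definition approx_bound (M : S) : \bar int :=
  infimum +oo%E [set (n%:Z)%:E | n in [set n : nat |
    approximated (big_gen G (- n%:Z)%:E (n%:Z)%:E) (gen_le (-1)) M]].

Definition approx_index : \bar int :=
  supremum -oo%E [set x | exists M, gen_le0 M /\ x = approx_bound M].

End Dimensions.
End Triangulated.

(* Main.v *)
Require Import Defs.
From mathcomp Require Import all_boot all_order all_algebra.
From mathcomp Require Import all_classical constructive_ereal.
From mathcomp Require Import zify.
Import Defs.

(** If [X] is compact with Hom(G[m], X) = 0 for m >= 1, then [X] is bounded and of
    finite projective dimension d. Iterating the approximations gives a triangle
    E -> X -> D with E built from finitely many shifts G[j], j <= d + a(G), and D
    so deep in the aisle that X -> D vanishes; hence [X] is a retract of E, and a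
    compact retract of such an E is finitely built from the same shifts. The
    second inequality holds because an object finitely built from the G[j], j <= n,
    admits no maps to Y[i] for Y in the aisle and i > n + o^+(G).

    The finiteness of a(G) and o^+(G) is the comparison of [G] and its aisle with
    the generator and the t-structure witnessing weak approximability. The inclusion
    of the given aisle in a shift of the one generated by [G] uses that an object of
    the given aisle is the homotopy colimit of its iterated approximations. *)

Set Implicit Arguments.
Unset Strict Implicit.
Unset Printing Implicit Defensive.

Import Order.TTheory GRing.Theory Num.Theory.

Local Open Scope classical_set_scope.
Local Open Scope ring_scope.

(** * Triangles *)

(** Projective dimension is tested only on bounded objects of the aisle, so it kills X -> D only
    once D is known to be bounded; this is where Hom(G, G[i]) = 0 for i << 0 enters. The index a(G)
    is paid once, however many approximations are made: counted from 0, the k-th one is shifted by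
    k, so k of them reach exponents at most k - 1 + a(G). If X[q] lies in the aisle, k = q + d + 1
    of them, after the shift by q is undone, leave as remainder an aisle object shifted by d + 1,
    and the exponents stop at d + a(G). Two mismatches between classes have to be bridged. The
    approximations use infinite coproducts, while [findim] asks for finite constructions: a map from
    a compact object into such a closure factors through a finitely built object. They also allow
    direct summands, while the aisle of G is defined without them: telescopes of idempotents absorb
    retracts as soon as the generating class is stable under suspension. *)

Section Preadditive.
Variable C : preadditiveCategory.
Implicit Types X Y Z W : C.

Lemma comp0l X Y Z (f : hom X Y) : (0 : hom Y Z) \oc f = 0.
Proof. by apply: (@addIr _ ((0 : hom Y Z) \oc f)); rewrite -compDl !add0r. Qed.

Lemma comp0r X Y Z (g : hom Y Z) : g \oc (0 : hom X Y) = 0.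
Proof. by apply: (@addIr _ (g \oc (0 : hom X Y))); rewrite -compDr !add0r. Qed.

Lemma compNl X Y Z (g : hom Y Z) (f : hom X Y) : (- g) \oc f = - (g \oc f).
Proof. by apply: (@addIr _ (g \oc f)); rewrite -compDl !addNr comp0l. Qed.

Lemma compNr X Y Z (g : hom Y Z) (f : hom X Y) : g \oc (- f) = - (g \oc f).
Proof. by apply: (@addIr _ (g \oc f)); rewrite -compDr !addNr comp0r. Qed.

Lemma compBl X Y Z (g g' : hom Y Z) (f : hom X Y) :
  (g - g') \oc f = g \oc f - g' \oc f.
Proof. by rewrite compDl compNl. Qed.

Lemma compBr X Y Z (g : hom Y Z) (f f' : hom X Y) :
  g \oc (f - f') = g \oc f - g \oc f'.
Proof. by rewrite compDr compNr. Qed.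

Lemma comp_suml X Y Z I (s : seq I) (P : pred I) (g : I -> hom Y Z)
    (f : hom X Y) :
  (\sum_(i <- s | P i) g i) \oc f = \sum_(i <- s | P i) (g i \oc f).
Proof.
by apply: (big_morph (fun g => g \oc f)) => [g1 g2|]; rewrite ?compDl ?comp0l.
Qed.

Lemma comp_sumr X Y Z I (s : seq I) (P : pred I) (g : hom Y Z)
    (f : I -> hom X Y) :
  g \oc (\sum_(i <- s | P i) f i) = \sum_(i <- s | P i) (g \oc f i).
Proof.
by apply: (big_morph (comp g)) => [f1 f2|]; rewrite ?compDr ?comp0r.
Qed.

Lemma is_iso_id X : is_iso (idm X).
Proof. by exists (idm X); rewrite comp1m. Qed.

Lemma is_iso_inv X Y (f : hom X Y) :
  is_iso f -> exists2 g, is_iso g & g \oc f = idm X /\ f \oc g = idm Y.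
Proof. by move=> [g [gf fg]]; exists g => //; exists f. Qed.

Lemma is_iso_comp X Y Z (g : hom Y Z) (f : hom X Y) :
  is_iso g -> is_iso f -> is_iso (g \oc f).
Proof.
move=> [g' [g'g gg']] [f' [f'f ff']]; exists (f' \oc g'); split.
  by rewrite -compA (compA g') g'g comp1m.
by rewrite -compA (compA f) ff' comp1m.
Qed.

Lemma is_iso_opp X Y (f : hom X Y) : is_iso f -> is_iso (- f).
Proof.
by move=> [g [gf fg]]; exists (- g); rewrite !compNl !compNr !opprK.
Qed.

Lemma iso_cancell X Y Z (f : hom Y Z) (g h : hom X Y) :
  is_iso f -> f \oc g = f \oc h -> g = h.
Proof.
by move=> [k [kf _]] e; rewrite -(comp1m g) -(comp1m h) -kf -!compA e.
Qed.

Lemma iso_cancelr X Y Z (f : hom X Y) (g h : hom Y Z) :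
  is_iso f -> g \oc f = h \oc f -> g = h.
Proof.
by move=> [k [_ fk]] e; rewrite -(compm1 g) -(compm1 h) -fk !compA e.
Qed.

Lemma isomorphic_refl X : isomorphic X X.
Proof. by exists (idm X); exact: is_iso_id. Qed.

Lemma isomorphic_sym X Y : isomorphic X Y -> isomorphic Y X.
Proof. by move=> [f /is_iso_inv[g gi _]]; exists g. Qed.

Lemma isomorphic_trans X Y Z :
  isomorphic X Y -> isomorphic Y Z -> isomorphic X Z.
Proof. by move=> [f fi] [g gi]; exists (g \oc f); exact: is_iso_comp. Qed.

(** No complement is asked for, so functors and coproducts preserve the notion at once;
    [retract_summand] gives the complement back. *)
Definition retract X Y : Prop :=
  exists (i : hom X Y) (p : hom Y X), p \oc i = idm X.

Lemma isomorphic_retract X Y : isomorphic X Y -> retract X Y.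
Proof. by move=> [f [g [gf _]]]; exists f, g. Qed.

Lemma retract_trans X Y Z : retract X Y -> retract Y Z -> retract X Z.
Proof.
move=> [i [p pi]] [j [q qj]]; exists (j \oc i), (p \oc q).
by rewrite -compA (compA q) qj comp1m.
Qed.

Lemma zero_object_id Z : is_zero_object Z <-> idm Z = 0.
Proof.
split=> [/(_ Z)[h _]|id0 X]; first exact: h.
by split=> f; rewrite -(comp1m f) -(compm1 f) id0 ?comp0l ?comp0r.
Qed.

Lemma hom_to0 X Y (f : hom X Y) : is_zero_object Y -> f = 0.
Proof. by move=> /(_ X)[h _]; exact: h. Qed.

Lemma hom_from0 X Y (f : hom X Y) : is_zero_object X -> f = 0.
Proof. by move=> /(_ Y)[_ h]; exact: h. Qed.

End Preadditive.

Section Functor.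
Variables (C : preadditiveCategory) (T : additiveEndofunctor C).
Implicit Types X Y Z : C.

Lemma fmap0 X Y : fmap T (0 : hom X Y) = 0.
Proof. by apply: (@addIr _ (fmap T (0 : hom X Y))); rewrite -fmapD !add0r. Qed.

Lemma fmap_sum X Y I (s : seq I) (P : pred I) (f : I -> hom X Y) :
  fmap T (\sum_(i <- s | P i) f i) = \sum_(i <- s | P i) fmap T (f i).
Proof. by apply: (big_morph (fmap T)) => [f1 f2|]; rewrite ?fmapD ?fmap0. Qed.

Lemma fmap_iso X Y (f : hom X Y) : is_iso f -> is_iso (fmap T f).
Proof.
by move=> [g [gf fg]]; exists (fmap T g); rewrite -!fmap_comp gf fg !fmap1.
Qed.

Lemma fobj_isomorphic X Y : isomorphic X Y -> isomorphic (T X) (T Y).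
Proof. by move=> [f fi]; exists (fmap T f); exact: fmap_iso. Qed.

Lemma fobj_retract X Y : retract X Y -> retract (T X) (T Y).
Proof.
by move=> [i [p pi]]; exists (fmap T i), (fmap T p); rewrite -fmap_comp pi fmap1.
Qed.

Definition equivalence : Prop :=
  [/\ forall X Y, injective (@fmap C T X Y),
      forall X Y (g : hom (T X) (T Y)), exists f, fmap T f = g
    & forall Y, exists X, isomorphic Y (T X)].

End Functor.

Section Suspension.
Variable S : triangulatedCategory.
Implicit Types X Y Z W : S.

Lemma susp_inj X Y : injective (@fmap S susp X Y).
Proof.
move=> f g fg; apply: (iso_cancell (susp_unit_iso Y)).
by rewrite !susp_unit_nat fg.
Qed.

Lemma desusp_inj X Y : injective (@fmap S desusp X Y).
Proof.
move=> f g fg; apply: (iso_cancelr (susp_counit_iso X)).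
by rewrite -!susp_counit_nat fg.
Qed.

Lemma susp_full X Y (k : hom (susp X) (susp Y)) : exists f, fmap susp f = k.
Proof.
have [v _ [vu uv]] := is_iso_inv (susp_unit_iso Y).
exists (v \oc fmap desusp k \oc susp_unit X); apply: desusp_inj.
apply: (iso_cancelr (susp_unit_iso X)).
by rewrite -susp_unit_nat !compA uv comp1m.
Qed.

Lemma desusp_full X Y (k : hom (desusp X) (desusp Y)) :
  exists f, fmap desusp f = k.
Proof.
have [v _ [vu uv]] := is_iso_inv (susp_counit_iso X).
exists (susp_counit Y \oc fmap susp k \oc v); apply: susp_inj.
apply: (iso_cancell (susp_counit_iso Y)).
by rewrite susp_counit_nat -!compA vu compm1.
Qed.

Lemma susp_equivalence : equivalence (@susp S).
Proof.
split; [exact: susp_inj|exact: susp_full|move=> Y; exists (desusp Y)].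
by apply: isomorphic_sym; exists (susp_counit Y); exact: susp_counit_iso.
Qed.

Lemma desusp_equivalence : equivalence (@desusp S).
Proof.
split; [exact: desusp_inj|exact: desusp_full|move=> Y; exists (susp Y)].
by exists (susp_unit Y); exact: susp_unit_iso.
Qed.

Lemma suspK X : isomorphic (desusp (susp X)) X.
Proof.
by apply: isomorphic_sym; exists (susp_unit X); exact: susp_unit_iso.
Qed.

Lemma desuspK X : isomorphic (susp (desusp X)) X.
Proof. by exists (susp_counit X); exact: susp_counit_iso. Qed.

End Suspension.

Section Triangles.
Variable S : triangulatedCategory.
Implicit Types X Y Z W A B : S.

Lemma zero_object_exists : exists Z : S, is_zero_object Z.
Proof. by case: (tcat_additive S). Qed.

Lemma dist_rot1 X Y Z (f : hom X Y) (g : hom Y Z) (h : hom Z (susp X)) :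
  dist f g h -> dist g h (- fmap susp f).
Proof. by move/dist_rot. Qed.

Lemma dist_comp0 X Y Z (f : hom X Y) (g : hom Y Z) (h : hom Z (susp X)) :
  dist f g h -> g \oc f = 0.
Proof.
move=> d; have [O O0] := zero_object_exists.
have [|c [e _]] := dist_fill (dist_id X O0) d (a := idm X) (b := f) => //.
by rewrite -e comp0r.
Qed.

Lemma dist_susp_comp0 X Y Z (f : hom X Y) (g : hom Y Z) (h : hom Z (susp X)) :
  dist f g h -> fmap susp f \oc h = 0.
Proof.
by move/dist_rot1/dist_rot1/dist_comp0 => e; apply: oppr_inj; rewrite oppr0 -compNl.
Qed.

Lemma zero_object_fobj (T : additiveEndofunctor S) X :
  is_zero_object X -> is_zero_object (T X).
Proof. by rewrite !zero_object_id -fmap1 => ->; rewrite fmap0. Qed.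

Lemma dist_id_right W Z : is_zero_object Z ->
  dist (0 : hom Z W) (idm W) (0 : hom W (susp Z)).
Proof.
move=> Z0; apply/dist_rot; rewrite fmap0 oppr0.
exact: dist_id (zero_object_fobj susp Z0).
Qed.

Lemma dist_factorr X Y Z W (f : hom X Y) (g : hom Y Z) (h : hom Z (susp X))
    (a : hom Y W) :
  dist f g h -> a \oc f = 0 -> exists b : hom Z W, a = b \oc g.
Proof.
move=> d af; have [O O0] := zero_object_exists.
have [|c [e _]] := dist_fill d (dist_id_right W O0) (a := 0) (b := a).
  by rewrite af comp0l.
by exists c; rewrite e comp1m.
Qed.

Lemma dist_fill12 X Y Z X' Y' Z' (f : hom X Y) (g : hom Y Z)
    (h : hom Z (susp X)) (f' : hom X' Y') (g' : hom Y' Z')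
    (h' : hom Z' (susp X')) (b : hom Y Y') (c : hom Z Z') :
  dist f g h -> dist f' g' h' -> c \oc g = g' \oc b ->
  exists a : hom X X', b \oc f = f' \oc a /\ fmap susp a \oc h = h' \oc c.
Proof.
move=> /dist_rot1 d /dist_rot1 d' e.
have [k [e1 e2]] := dist_fill d d' e.
have [a ka] := susp_full k; exists a; rewrite ka e1; split=> //.
apply: susp_inj; rewrite !fmap_comp ka.
by apply: oppr_inj; rewrite -compNr e2 compNl.
Qed.

Lemma dist_fill13 X Y Z X' Y' Z' (f : hom X Y) (g : hom Y Z)
    (h : hom Z (susp X)) (f' : hom X' Y') (g' : hom Y' Z')
    (h' : hom Z' (susp X')) (a : hom X X') (c : hom Z Z') :
  dist f g h -> dist f' g' h' -> fmap susp a \oc h = h' \oc c ->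
  exists b : hom Y Y', b \oc f = f' \oc a /\ c \oc g = g' \oc b.
Proof.
move=> /dist_rot1 d /dist_rot1 d' e.
by have [b [e1 e2]] := dist_fill12 d d' e; exists b; split=> //;
  apply: susp_inj; rewrite !fmap_comp; apply: oppr_inj; rewrite -compNr e2 compNl.
Qed.

Lemma dist_factorl X Y Z W (f : hom X Y) (g : hom Y Z) (h : hom Z (susp X))
    (a : hom W Y) :
  dist f g h -> g \oc a = 0 -> exists b : hom W X, a = f \oc b.
Proof.
move=> d ga; have [O O0] := zero_object_exists.
have [|c [e _]] := dist_fill12 (dist_id W O0) d (b := a) (c := 0).
  by rewrite ga comp0l.
by exists c; rewrite -e compm1.
Qed.

Lemma dist_susp_factorl X Y Z W (f : hom X Y) (g : hom Y Z)
    (h : hom Z (susp X)) (a : hom W X) :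
  dist f g h -> f \oc a = 0 -> exists b : hom (susp W) Z, fmap susp a = h \oc b.
Proof.
move=> d fa; apply: (dist_factorl (dist_rot1 (dist_rot1 d))).
by rewrite compNl -fmap_comp fa fmap0 oppr0.
Qed.

Lemma dist_zero_iso X Y Z (f : hom X Y) (g : hom Y Z) (h : hom Z (susp X)) :
  dist f g h -> is_zero_object Z -> is_iso f.
Proof.
move=> d Z0.
have [|r fr] := dist_factorl d (a := idm Y); first exact: hom_to0.
exists r; split=> //.
have [|b e] := dist_susp_factorl d (a := r \oc f - idm X).
  by rewrite compBr compA -fr comp1m compm1 subrr.
apply/eqP; rewrite -subr_eq0; apply/eqP/susp_inj.
by rewrite e fmap0 (hom_to0 b Z0) comp0r.
Qed.

(* Such a [c] differs from the identity by a map of square zero, which makes the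
   five lemma unnecessary. *)
Lemma dist_endo_iso X Y Z (f : hom X Y) (g : hom Y Z) (h : hom Z (susp X))
    (c : hom Y Y) :
  dist f g h -> c \oc f = f -> g \oc c = g -> is_iso c.
Proof.
move=> d cf gc; set n := c - idm Y.
have [|u nu] := dist_factorr d (a := n); first by rewrite compBl cf comp1m subrr.
have [|v nv] := dist_factorl d (a := n); first by rewrite compBr gc compm1 subrr.
have nn : n \oc n = 0.
  by rewrite {1}nu nv -compA (compA g) (dist_comp0 d) comp0l comp0r.
have -> : c = idm Y + n by rewrite /n addrC subrK.
exists (idm Y - n); split.
  by rewrite compBl comp1m compDr compm1 nn addr0 addrK.
by rewrite compBr compm1 compDl comp1m nn addr0 addrK.
Qed.

Lemma dist_complete2 Y Z (g : hom Y Z) :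
  exists (X : S) (f : hom X Y) (h : hom Z (susp X)), dist f g h.
Proof.
have [W [g' [g'' d]]] := dist_cone g.
have [e ei] := desuspK W; have [e' [e'e ee']] := ei.
have [f ef] := susp_full (- (g'' \oc e)).
exists (desusp W), f, (e' \oc g'); apply/dist_rot.
rewrite ef opprK.
have e'i : is_iso e' by exists e.
apply: (dist_iso (is_iso_id _) (is_iso_id _) e'i _ _ _ d).
- by rewrite comp1m compm1.
- by rewrite compm1.
- by rewrite fmap1 comp1m -compA ee' compm1.
Qed.

Lemma dist_complete3 X Z (h : hom Z (susp X)) :
  exists (Y : S) (f : hom X Y) (g : hom Y Z), dist f g h.
Proof.
have [Y [g [k d]]] := dist_complete2 h.
have [f ef] := susp_full (- k).
by exists Y, f, g; apply/dist_rot; rewrite ef opprK.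
Qed.

(** The connecting map [h] of a split monomorphism vanishes, because [fmap susp i] kills it and is
    itself split; hence [q] splits and the cone is the complement. *)
Lemma retract_summand X Y : retract X Y <-> is_summand X Y.
Proof.
split=> [[i [p pi]]|[Z [i [j [p [q [pi _ _ _ _]]]]]]]; last by exists i, p.
have [Z [q [h d]]] := dist_cone i.
have ip : (idm Y - i \oc p) \oc i = 0 by rewrite compBl -compA pi compm1 comp1m subrr.
have [j ej] := dist_factorr d ip.
have qi := dist_comp0 d.
have h0 : h = 0.
  by rewrite -[h]comp1m -fmap1 -pi fmap_comp -compA (dist_susp_comp0 d) comp0r.
have [|r er] := dist_factorl (dist_rot1 d) (a := idm Z).
  by rewrite h0 comp0l.
have qj : q \oc j = idm Z.
  rewrite -[q \oc j]compm1 er compA -(compA q) -ej compBr compm1 compA qi.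
  by rewrite comp0l subr0.
have pj : p \oc j = 0.
  rewrite -[p \oc j]compm1 er compA -(compA p) -ej compBr compm1 compA pi.
  by rewrite comp1m subrr comp0l.
exists Z, i, j, p, q; split=> //.
by rewrite -ej addrC subrK.
Qed.

(** Closure properties need only the three objects; forgetting the maps removes the signs that
    rotations and shifts introduce. *)
Definition tri X Y Z : Prop :=
  exists (f : hom X Y) (g : hom Y Z) (h : hom Z (susp X)), dist f g h.

Lemma dist_tri X Y Z (f : hom X Y) (g : hom Y Z) (h : hom Z (susp X)) :
  dist f g h -> tri X Y Z.
Proof. by exists f, g, h. Qed.

Lemma tri_rot X Y Z : tri X Y Z -> tri Y Z (susp X).
Proof. by move=> [f [g [h /dist_rot1/dist_tri]]]. Qed.

Lemma tri_iso X Y Z X' Y' Z' : isomorphic X X' -> isomorphic Y Y' ->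
  isomorphic Z Z' -> tri X Y Z -> tri X' Y' Z'.
Proof.
move=> [a ai] [b bi] [c ci] [f [g [h d]]].
have [a' _ [a'a aa']] := is_iso_inv ai.
have [b' _ [b'b bb']] := is_iso_inv bi.
have [c' _ [c'c cc']] := is_iso_inv ci.
exists (b \oc f \oc a'), (c \oc g \oc b'), (fmap susp a \oc h \oc c').
apply: (dist_iso ai bi ci _ _ _ d).
- by rewrite -compA a'a compm1.
- by rewrite -compA b'b compm1.
- by rewrite -compA c'c compm1.
Qed.

Lemma iso_of_composites X Y (f : hom X Y) (g : hom Y X) :
  is_iso (g \oc f) -> is_iso (f \oc g) -> is_iso f.
Proof.
move=> [u [ugf _]] [v [_ fgv]]; exists (g \oc v); split; last by rewrite compA.
by rewrite -[g \oc v]comp1m -ugf -!compA (compA f) (compA (f \oc g)) fgv comp1m.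
Qed.

(** The fillers in the two directions compose to endomorphisms that fix both maps adjacent to the
    cone, so [dist_endo_iso] applies to either composite. *)
Lemma cone_unique X Y Z X' Y' Z' (f : hom X Y) (g : hom Y Z)
    (h : hom Z (susp X)) (f' : hom X' Y') (g' : hom Y' Z')
    (h' : hom Z' (susp X')) (a : hom X X') (b : hom Y Y') :
  dist f g h -> dist f' g' h' -> is_iso a -> is_iso b -> b \oc f = f' \oc a ->
  isomorphic Z Z'.
Proof.
move=> d d' ai bi e.
have [a' _ [a'a aa']] := is_iso_inv ai.
have [b' _ [b'b bb']] := is_iso_inv bi.
have e' : b' \oc f' = f \oc a'.
  by rewrite -[f']compm1 -aa' (compA f') -e !compA b'b comp1m.
have [c [c1 c2]] := dist_fill d d' e; have [k [k1 k2]] := dist_fill d' d e'.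
exists c; apply: (iso_of_composites (g := k)).
  apply: (dist_endo_iso (dist_rot1 d)).
    by rewrite -compA c1 compA k1 -compA b'b compm1.
  by rewrite compA -k2 -compA -c2 compA -fmap_comp a'a fmap1 comp1m.
apply: (dist_endo_iso (dist_rot1 d')).
  by rewrite -compA k1 compA c1 -compA bb' compm1.
by rewrite compA -c2 -compA -k2 compA -fmap_comp aa' fmap1 comp1m.
Qed.

Lemma tri_susp X Y Z : tri X Y Z -> tri (susp X) (susp Y) (susp Z).
Proof. by move/tri_rot/tri_rot/tri_rot. Qed.

(** Rotation only produces suspensions. Here the cone of [fmap desusp f] is suspended and compared
    with [Z] by uniqueness of cones; the sign of three rotations is absorbed into the counit. *)
Lemma tri_desusp X Y Z : tri X Y Z -> tri (desusp X) (desusp Y) (desusp Z).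
Proof.
move=> [f [g [h d]]].
have [W [g0 [h0 d0]]] := dist_cone (fmap desusp f).
have /isomorphic_sym ZW : isomorphic (susp W) Z.
  apply: (cone_unique (dist_rot1 (dist_rot1 (dist_rot1 d0))) d
    (is_iso_opp (susp_counit_iso X)) (susp_counit_iso Y)).
  by rewrite !compNr susp_counit_nat.
apply: tri_iso (dist_tri d0); try exact: isomorphic_refl.
apply: isomorphic_trans (isomorphic_sym (suspK W)) _.
exact: fobj_isomorphic (isomorphic_sym ZW).
Qed.

Lemma tri_unsusp X Y Z : tri (susp X) (susp Y) (susp Z) -> tri X Y Z.
Proof. by move/tri_desusp; apply: tri_iso; exact: suspK. Qed.

(** The octahedral axiom read on cocones: the cocone V of Y -> C -> B is an extension of the cocone
    A of the second map by the cocone X of the first. This glues one more approximation onto a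
    tower, and [a] is the transition map. *)
Lemma dist_cocone_comp X Y A B C (f : hom X Y) (g : hom Y C)
    (h : hom C (susp X)) (u : hom A C) (v : hom C B) (w : hom B (susp A)) :
  dist f g h -> dist u v w ->
  exists (V : S) (k : hom V Y) (l : hom B (susp V)) (a : hom X V),
    [/\ dist k (v \oc g) l, k \oc a = f & tri X V A].
Proof.
move=> d d'; have [V [k [l dk]]] := dist_complete2 (v \oc g).
have [b [c [t _ kb _ _]]] :=
  dist_oct (dist_rot1 d) (dist_rot1 d') (dist_rot1 dk).
have [a ea] := susp_full b; exists V, k, l, a; split=> //.
  apply: susp_inj; apply: oppr_inj.
  by rewrite -kb -ea compNl -fmap_comp.
exact: tri_unsusp (dist_tri t).
Qed.

End Triangles.

(** * Shifts, coproducts and compact objects *)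

Section Shift.
Variable S : triangulatedCategory.
Implicit Types (X Y Z W : S) (m n : int).

Lemma shift_isomorphic X Y n :
  isomorphic X Y -> isomorphic (shift X n) (shift Y n).
Proof.
by case: n => n XY /=; elim: n => [|n IH] //=; exact: fobj_isomorphic.
Qed.

Lemma shiftS X n : isomorphic (shift X (n + 1)) (susp (shift X n)).
Proof.
case: n => [n|[|n]]; first by rewrite -PoszD addn1; exact: isomorphic_refl.
  exact: isomorphic_sym (desuspK X).
have -> : Negz n.+1 + 1 = Negz n by lia.
by apply: isomorphic_sym; exact: desuspK.
Qed.

Lemma shiftB1 X n : isomorphic (shift X (n - 1)) (desusp (shift X n)).
Proof.
have := shiftS X (n - 1); rewrite subrK => /isomorphic_sym h.
exact: isomorphic_trans (isomorphic_sym (suspK _)) (fobj_isomorphic _ h).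
Qed.

Lemma shiftD X m n : isomorphic (shift (shift X m) n) (shift X (m + n)).
Proof.
elim/int_rect: n => [|n IH|n IH].
- by rewrite addr0; exact: isomorphic_refl.
- have -> : m + n.+1%:Z = m + n%:Z + 1 by lia.
  have -> : n.+1%:Z = n%:Z + 1 by lia.
  apply: isomorphic_trans (shiftS _ _) _.
  apply: isomorphic_trans _ (isomorphic_sym (shiftS _ _)).
  exact: fobj_isomorphic.
- have -> : m - n.+1%:Z = m - n%:Z - 1 by lia.
  have -> : - n.+1%:Z = - n%:Z - 1 by lia.
  apply: isomorphic_trans (shiftB1 _ _) _.
  apply: isomorphic_trans _ (isomorphic_sym (shiftB1 _ _)).
  exact: fobj_isomorphic.
Qed.

Lemma shift_eq X m n k : m + n = k ->
  isomorphic (shift (shift X m) n) (shift X k).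
Proof. by move=> <-; exact: shiftD. Qed.

Lemma shiftK X n : isomorphic (shift (shift X n) (- n)) X.
Proof. by apply: shift_eq (_ : _ = 0); rewrite subrr. Qed.

Lemma shift_tri X Y Z n : tri X Y Z -> tri (shift X n) (shift Y n) (shift Z n).
Proof.
case: n => n t /=; elim: n => [|n IH] //=.
- exact: tri_susp.
- exact: tri_desusp.
- exact: tri_desusp.
Qed.

Lemma shift_retract X Y n : retract X Y -> retract (shift X n) (shift Y n).
Proof. by case: n => n r /=; elim: n => [|n IH] //=; exact: fobj_retract. Qed.

Lemma hom_zero_retract X X' Y Y' :
  retract X X' -> retract Y Y' -> hom_zero X' Y' -> hom_zero X Y.
Proof.
move=> [i [p pi]] [j [q qj]] XY f.
rewrite -[f]comp1m -[f]compm1 -pi -qj.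
have e : j \oc (f \oc p) = 0 by exact: XY.
by rewrite -compA (compA f) (compA j) e comp0l comp0r.
Qed.

Lemma hom_zero_iso X X' Y Y' : isomorphic X X' -> isomorphic Y Y' ->
  hom_zero X Y -> hom_zero X' Y'.
Proof.
by move=> XX YY; apply: hom_zero_retract;
  exact/isomorphic_retract/isomorphic_sym.
Qed.

Lemma hom_zero_fobj (T : additiveEndofunctor S) X Y : equivalence T ->
  hom_zero (T X) (T Y) <-> hom_zero X Y.
Proof.
move=> [Tinj Tfull _]; split=> h f; first by apply: Tinj; rewrite fmap0.
by have [g <-] := Tfull _ _ f; rewrite (h g) fmap0.
Qed.

Lemma hom_zero_shift2 X Y n :
  hom_zero (shift X n) (shift Y n) <-> hom_zero X Y.
Proof.
have s := susp_equivalence S; have d := desusp_equivalence S.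
case: n => n /=; elim: n => [|n IH] //=.
- exact: iff_trans (hom_zero_fobj _ _ s) IH.
- exact: hom_zero_fobj d.
- exact: iff_trans (hom_zero_fobj _ _ d) IH.
Qed.

Lemma hom_zero_shiftD X Y m n k :
  hom_zero (shift X (m + k)) (shift Y (n + k)) <->
  hom_zero (shift X m) (shift Y n).
Proof.
apply: iff_trans (hom_zero_shift2 _ _ k).
split; apply: hom_zero_iso;
  first [exact: shiftD | apply: isomorphic_sym; exact: shiftD].
Qed.

Lemma hom_zero_shift X Y m n m' n' : n - m = n' - m' ->
  hom_zero (shift X m) (shift Y n) -> hom_zero (shift X m') (shift Y n').
Proof.
move=> e; have e1 : m + (m' - m) = m' by lia.
have e2 : n + (m' - m) = n' by lia.
by move/(hom_zero_shiftD X Y m n (m' - m)); rewrite e1 e2.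
Qed.

Lemma hom_zero_tril X Y Z W :
  tri X Y Z -> hom_zero X W -> hom_zero Z W -> hom_zero Y W.
Proof.
move=> [f [g [h d]]] XW ZW a.
by have [|b ->] := dist_factorr d (a := a); rewrite ?(ZW b) ?comp0l.
Qed.

Lemma hom_zero_trir X Y Z W :
  tri X Y Z -> hom_zero W X -> hom_zero W Z -> hom_zero W Y.
Proof.
move=> [f [g [h d]]] XW ZW a.
by have [|b ->] := dist_factorl d (a := a); rewrite ?(XW b) ?comp0r.
Qed.

End Shift.

Lemma dep_choice I (T : I -> Type) (P : forall i, T i -> Prop) :
  (forall i, exists y, P i y) -> exists f : forall i, T i, forall i, P i (f i).
Proof.
by move=> h; exists (fun i => projT1 (cid (h i))) => i; case: (cid (h i)).
Qed.

Section Coproducts.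
Variable S : triangulatedCategory.
Implicit Types (X Y Z W : S) (I : choiceType).

Section Projections.
Variables (I : choiceType) (F : I -> S) (X : S) (inj : forall i, hom (F i) X).
Hypothesis Xcop : is_coproduct inj.

Lemma coproduct_ext Y (f g : hom X Y) :
  (forall i, f \oc inj i = g \oc inj i) -> f = g.
Proof.
move=> fg; have [h [_ uniq_h]] := Xcop (fun i => g \oc inj i).
by rewrite -(uniq_h f) // -(uniq_h g).
Qed.

Lemma coproduct_desc Y (g : forall i, hom (F i) Y) :
  exists h, forall i, h \oc inj i = g i.
Proof. by have [h [hg _]] := Xcop g; exists h. Qed.

Lemma coproduct_projections : exists p : forall i, hom X (F i),
  (forall i, p i \oc inj i = idm (F i)) /\
  (forall i j, i != j -> p i \oc inj j = 0).
Proof.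
pose k i j : hom (F j) (F i) :=
  if i =P j is ReflectT e then ecast l (hom (F j) (F l)) (esym e) (idm (F j))
  else 0.
have [p pk] := dep_choice (fun i => coproduct_desc (k i)).
exists p; split=> [i|i j ij]; rewrite pk /k; case: eqP => // e.
  by rewrite (eq_irrelevance (esym e) erefl).
by rewrite e eqxx in ij.
Qed.

End Projections.

Definition coproduct I (F : I -> S) X : Prop :=
  exists inj : forall i, hom (F i) X, is_coproduct inj.

(** One-term coproducts are what makes [Coprod] closed under isomorphism. *)
Lemma coproduct_unit X Y : isomorphic X Y -> coproduct (fun _ : unit => X) Y.
Proof.
move=> [f [f' [f'f ff']]]; exists (fun=> f) => Z g; exists (g tt \oc f').
split=> [[]|h hg]; first by rewrite -compA f'f compm1.
by rewrite -(hg tt) -compA ff' compm1.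
Qed.

Lemma coproduct_void (F : void -> S) Z : is_zero_object Z -> coproduct F Z.
Proof.
move=> Z0; exists (fun i => of_void _ i) => Y g; exists 0.
by split=> [[]|h _]; apply/esym/hom_from0.
Qed.

Lemma biproduct_coproduct X Y P : is_biproduct X Y P ->
  coproduct (fun b : bool => if b then X else Y) P.
Proof.
move=> [i [j [p [q [pi qj pj qi e]]]]].
exists (fun b => if b return hom (if b then X else Y) P then i else j).
move=> Z g; exists (g true \oc p + g false \oc q); split=> [[]|h hg].
- by rewrite compDl -!compA pi qi comp0r addr0 compm1.
- by rewrite compDl -!compA pj qj comp0r add0r compm1.
- by rewrite -[h]compm1 -e compDr !compA -(hg true) -(hg false).
Qed.

Lemma fmap_is_coproduct (T : additiveEndofunctor S) I (F : I -> S) X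
    (inj : forall i, hom (F i) X) :
  equivalence T -> is_coproduct inj -> is_coproduct (fun i => fmap T (inj i)).
Proof.
move=> [Tinj Tfull Tsurj] Xcop Y g; have [Y0 [a ai]] := Tsurj Y.
have [a' [a'a aa']] := ai.
have [k kP] := dep_choice (fun i => Tfull _ _ (a \oc g i)).
have [h hk] := coproduct_desc Xcop k.
exists (a' \oc fmap T h); split=> [i|h' h'g].
  by rewrite -compA -fmap_comp hk kP compA a'a comp1m.
have [h0 h0P] := Tfull _ _ (a \oc h').
have -> : h = h0.
  apply: (coproduct_ext Xcop) => i; rewrite hk; apply: Tinj.
  by rewrite kP fmap_comp h0P -compA h'g.
by rewrite h0P compA a'a comp1m.
Qed.

Lemma fobj_coproduct (T : additiveEndofunctor S) I (F : I -> S) X :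
  equivalence T -> coproduct F X -> coproduct (fun i => T (F i)) (T X).
Proof. by move=> eT [inj Xcop]; eexists; exact: fmap_is_coproduct eT Xcop. Qed.

Lemma shift_coproduct I (F : I -> S) X n :
  coproduct F X -> coproduct (fun i => shift (F i) n) (shift X n).
Proof.
have s := susp_equivalence S; have d := desusp_equivalence S.
case: n => n c /=; elim: n => [|n IH] //=.
- exact: (fobj_coproduct s IH).
- exact: fobj_coproduct d c.
- exact: (fobj_coproduct d IH).
Qed.

Lemma coproduct_retract I (F F' : I -> S) X X' :
  (forall i, retract (F i) (F' i)) -> coproduct F X -> coproduct F' X' ->
  retract X X'.
Proof.
move=> FF [inj Xcop] [inj' X'cop].
have [a aP] := dep_choice FF; have [b bP] := dep_choice aP.
have [i iP] := coproduct_desc Xcop (fun k => inj' k \oc a k).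
have [p pP] := coproduct_desc X'cop (fun k => inj k \oc b k).
exists i, p; apply: (coproduct_ext Xcop) => k.
by rewrite comp1m -compA iP compA pP -compA bP compm1.
Qed.

Lemma hom_zero_coproduct I (F : I -> S) X Y : coproduct F X ->
  (forall i, hom_zero (F i) Y) -> hom_zero X Y.
Proof.
move=> [inj Xcop] FY f; apply: (coproduct_ext Xcop) => i.
by rewrite (FY i (f \oc inj i)) comp0l.
Qed.

(* The injectivity half of [is_compact] is automatic, coproduct inclusions being
   split. *)
Definition cpt X : Prop :=
  forall I (F : I -> S) Y (inj : forall i, hom (F i) Y), is_coproduct inj ->
  forall h : hom X Y, exists s : seq {i & hom X (F i)},
    h = \sum_(x <- s) (inj (tag x) \oc tagged x).

Lemma is_compact_cpt X : is_compact X -> cpt X.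
Proof.
move=> Xc I F Y inj Ycop h; have [g [[gfin ->] _]] := Xc _ _ _ _ Ycop h.
exists [seq Tagged (fun i => hom X (F i)) (g i) |
  i <- finite_support 0 [set: I] (fun i => inj i \oc g i)].
by rewrite big_map.
Qed.

Lemma cpt_retract X X' : retract X X' -> cpt X' -> cpt X.
Proof.
move=> [a [b ba]] cX I F Y inj Ycop h.
have [s e] := cX _ _ _ _ Ycop (h \oc b).
exists [seq Tagged (fun i => hom X (F i)) (tagged x \oc a) | x <- s].
rewrite -[h]compm1 -ba compA e comp_suml big_map.
by apply: eq_bigr => i _; rewrite compA.
Qed.

Lemma cpt_fobj_inv (T : additiveEndofunctor S) X :
  equivalence T -> cpt (T X) -> cpt X.
Proof.
move=> eT cX I F Y inj Ycop h.
have [s e] := cX _ _ _ _ (fmap_is_coproduct eT Ycop) (fmap T h).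
have [Tinj Tfull _] := eT.
have [k kP] := dep_choice (fun x : {i & hom (T X) (T (F i))} => Tfull _ _ (tagged x)).
exists [seq Tagged (fun i => hom X (F i)) (k x) | x <- s].
apply: Tinj; rewrite e fmap_sum big_map.
by apply: eq_bigr => i _; rewrite fmap_comp kP.
Qed.

Lemma cpt_susp X : cpt X -> cpt (susp X).
Proof.
move=> cX; apply: (cpt_fobj_inv (desusp_equivalence S)).
exact: cpt_retract (isomorphic_retract (suspK X)) cX.
Qed.

Lemma cpt_desusp X : cpt X -> cpt (desusp X).
Proof.
move=> cX; apply: (cpt_fobj_inv (susp_equivalence S)).
exact: cpt_retract (isomorphic_retract (desuspK X)) cX.
Qed.

Lemma cpt_shift X n : cpt X -> cpt (shift X n).
Proof.
case: n => n c /=; elim: n => [|n IH] //=.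
- exact: cpt_susp.
- exact: cpt_desusp.
- exact: cpt_desusp.
Qed.

(** On maps from a compact object, some finite partial sum of the idempotents [inj i \oc p i] acts
    as the identity. *)
Lemma cpt_proj I (F : I -> S) X W (inj : forall i, hom (F i) X)
    (p : forall i, hom X (F i)) (h : hom W X) :
  is_coproduct inj ->
  (forall i, p i \oc inj i = idm (F i)) ->
  (forall i j, i != j -> p i \oc inj j = 0) ->
  cpt W -> exists s : seq I, h = (\sum_(i <- s) (inj i \oc p i)) \oc h.
Proof.
move=> Xcop pi pj cW; have [s ->] := cW _ _ _ _ Xcop h.
(* Repetitions are removed because each idempotent must occur only once in the sum. *)
exists (undup [seq tag x | x <- s]).
rewrite comp_sumr; apply: eq_big_seq => x xs.
have jt : tag x \in undup [seq tag x | x <- s] by rewrite mem_undup map_f.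
rewrite compA comp_suml (bigD1_seq _ jt) ?undup_uniq //= -(compA (inj _) (p _)).
rewrite pi compm1 big1 ?addr0 // => i ij.
by rewrite -compA pj // comp0r.
Qed.

(** A finite partial sum [e] of idempotents fixes [k \oc f]; the rest [k - e \oc k] vanishes on X,
    hence factors through the compact Z. *)
Lemma cpt_tri X Y Z : tri X Y Z -> cpt X -> cpt Z -> cpt Y.
Proof.
move=> [f [g [h d]]] cX cZ I F W inj Wcop k.
have [p [pi pj]] := coproduct_projections Wcop.
have [s es] := cpt_proj (k \oc f) Wcop pi pj cX.
set e := \sum_(i <- s) _ in es.
have [|u eu] := dist_factorr d (a := k - e \oc k).
  by rewrite compBl -compA -es subrr.
have [s' eu'] := cZ _ _ _ _ Wcop u.
exists ([seq Tagged (fun i => hom Y (F i)) (p i \oc k) | i <- s] ++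
        [seq Tagged (fun i => hom Y (F i)) (tagged x \oc g) | x <- s']).
rewrite big_cat !big_map /= -[LHS](subrK (e \oc k)) eu addrC.
by congr (_ + _); rewrite ?eu' comp_suml; apply: eq_bigr => i _; rewrite compA.
Qed.

Lemma hom_zero_cpt_coproduct I (F : I -> S) X Y : coproduct F Y -> cpt X ->
  (forall i, hom_zero X (F i)) -> hom_zero X Y.
Proof.
move=> [inj Ycop] cX XF f; have [s ->] := cX _ _ _ _ Ycop f.
by rewrite big1 // => x _; rewrite (XF (tag x) (tagged x)) comp0r.
Qed.

End Coproducts.

(** * Extension closures *)

Section Closures.
Variable S : triangulatedCategory.
Implicit Types (X Y Z W c : S) (P Q : S -> Prop) (n : int) (I : choiceType).

Lemma Coprod_coproduct P I (F : I -> S) X :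
  coproduct F X -> (forall i, Coprod P (F i)) -> Coprod P X.
Proof. by move=> [inj Xcop] PF; exact: Coprod_coprod PF Xcop. Qed.

Lemma Coprod_tri P X Y Z : tri X Y Z -> Coprod P X -> Coprod P Z -> Coprod P Y.
Proof. by move=> [f [g [h d]]]; exact: Coprod_ext d. Qed.

Lemma Coprod_iso P X Y : isomorphic X Y -> Coprod P X -> Coprod P Y.
Proof. by move=> /coproduct_unit XY PX; exact: Coprod_coproduct XY _. Qed.

Lemma Coprod_min P Q : iso_closed Q ->
  (forall (I : choiceType) (F : I -> S) X,
    coproduct F X -> (forall i, Q (F i)) -> Q X) ->
  (forall X Y Z, tri X Y Z -> Q X -> Q Z -> Q Y) ->
  (forall X, P X -> Q X) -> forall X, Coprod P X -> Q X.
Proof.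
move=> Qiso Qcop Qtri PQ X; elim=> {X} [X /PQ //|I F X inj _ QF Xcop|].
  by apply: Qcop QF; exists inj.
by move=> X Y Z f g h /dist_tri d _ QX _ QZ; exact: Qtri d QX QZ.
Qed.

Lemma Coprod_iso_closed P : iso_closed (Coprod P).
Proof. by move=> X Y; exact: Coprod_iso. Qed.

Lemma Coprod_mono P Q : (forall X, P X -> Coprod Q X) ->
  forall X, Coprod P X -> Coprod Q X.
Proof.
apply: Coprod_min => [|I F X|X Y Z]; first exact: Coprod_iso_closed.
- exact: Coprod_coproduct.
- exact: Coprod_tri.
Qed.

Lemma Coprod_shift P Q n : (forall X, P X -> Coprod Q (shift X n)) ->
  forall X, Coprod P X -> Coprod Q (shift X n).
Proof.
apply: (@Coprod_min P (fun X => Coprod Q (shift X n))) => [X Y|I F X|X Y Z].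
- by move/shift_isomorphic => /(_ n); exact: Coprod_iso.
- by move/shift_coproduct => /(_ n); exact: Coprod_coproduct.
- by move/shift_tri => /(_ n); exact: Coprod_tri.
Qed.

Definition rCoprod P X : Prop := exists2 Y, Coprod P Y & retract X Y.

Lemma Coprod_rCoprod P X : Coprod P X -> rCoprod P X.
Proof. by exists X => //; exact/isomorphic_retract/isomorphic_refl. Qed.

Lemma rCoprod_retract P X Y : retract X Y -> rCoprod P Y -> rCoprod P X.
Proof. by move=> XY [Z PZ YZ]; exists Z => //; exact: retract_trans YZ. Qed.

Lemma rCoprod_iso_closed P : iso_closed (rCoprod P).
Proof. by move=> X Y /isomorphic_sym/isomorphic_retract; exact: rCoprod_retract. Qed.

(** The outer retractions carry the connecting map to one between X' and Z', whose triangle has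
    middle term Y'. The fillers Y -> Y' -> Y need not compose to the identity, but the composite
    fixes [f] and [g], so it is invertible and can be corrected. *)
Lemma rCoprod_tri P X Y Z :
  tri X Y Z -> rCoprod P X -> rCoprod P Z -> rCoprod P Y.
Proof.
move=> [f [g [h d]]] [X' PX' [i [p pi]]] [Z' PZ' [j [q qj]]].
have [Y' [f' [g' d']]] := dist_complete3 (fmap susp i \oc h \oc q).
exists Y'; first by exact: Coprod_ext d' PX' PZ'.
have [|a [a1 a2]] := dist_fill13 d d' (a := i) (c := j).
  by rewrite -[in RHS]compA qj compm1.
have [|b [b1 b2]] := dist_fill13 d' d (a := p) (c := q).
  by rewrite !compA -fmap_comp pi fmap1 comp1m.
have [||u [uba _]] := @dist_endo_iso S _ _ _ f g h (b \oc a) d.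
- by rewrite -compA a1 compA b1 -compA pi compm1.
- by rewrite compA -b2 -compA -a2 compA qj comp1m.
by exists a, (u \oc b); rewrite -compA.
Qed.

Lemma rCoprod_coproduct P I (F : I -> S) X : has_coproducts S ->
  coproduct F X -> (forall i, rCoprod P (F i)) -> rCoprod P X.
Proof.
move=> Scop XF PF.
have /dep_choice[F' F'P] : forall i, exists Y, Coprod P Y /\ retract (F i) Y.
  by move=> i; have [Y] := PF i; exists Y.
have [X' [inj X'cop]] := Scop I F'.
have cX' : coproduct F' X' by exists inj.
exists X'; first by apply: Coprod_coproduct cX' _ => i; case: (F'P i).
by apply: coproduct_retract XF cX' => i; case: (F'P i).
Qed.

Lemma rCoprod_min P Q : (forall X Y, retract X Y -> Q Y -> Q X) ->
  (forall (I : choiceType) (F : I -> S) X,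
    coproduct F X -> (forall i, Q (F i)) -> Q X) ->
  (forall X Y Z, tri X Y Z -> Q X -> Q Z -> Q Y) ->
  (forall X, P X -> Q X) -> forall X, rCoprod P X -> Q X.
Proof.
move=> Qret Qcop Qtri PQ X [Y PY XY]; apply: (Qret _ _ XY).
apply: Coprod_min PY => // Z W /isomorphic_sym/isomorphic_retract.
exact: Qret.
Qed.

Lemma rCoprod_mono P Q : has_coproducts S ->
  (forall X, P X -> rCoprod Q X) -> forall X, rCoprod P X -> rCoprod Q X.
Proof.
move=> Scop; apply: rCoprod_min => [X Y|I F X|X Y Z].
- exact: rCoprod_retract.
- exact: rCoprod_coproduct.
- exact: rCoprod_tri.
Qed.

Lemma rCoprod_hom_zerol P W : (forall X, P X -> hom_zero X W) ->
  forall X, rCoprod P X -> hom_zero X W.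
Proof.
apply: (@rCoprod_min P (fun X => hom_zero X W)) => [X Y|I F X|X Y Z].
- move=> XY; apply: hom_zero_retract XY _.
  exact/isomorphic_retract/isomorphic_refl.
- exact: hom_zero_coproduct.
- exact: hom_zero_tril.
Qed.

Lemma rCoprod_hom_zeror P c : cpt c -> (forall X, P X -> hom_zero c X) ->
  forall X, rCoprod P X -> hom_zero c X.
Proof.
move=> cc; apply: (@rCoprod_min P (fun X => hom_zero c X)) => [X Y|I F X|X Y Z].
- apply: hom_zero_retract.
  exact/isomorphic_retract/isomorphic_refl.
- by move=> FX; exact: hom_zero_cpt_coproduct FX cc.
- exact: hom_zero_trir.
Qed.

Lemma small_retract P X Y : retract X Y -> small_closure P Y -> small_closure P X.
Proof. by move/retract_summand; exact: small_summand. Qed.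

Lemma small_min P Q : (forall X Y, retract X Y -> Q Y -> Q X) ->
  (forall X, is_zero_object X -> Q X) ->
  (forall X Y Z, is_biproduct X Y Z -> Q X -> Q Y -> Q Z) ->
  (forall X Y Z, tri X Y Z -> Q X -> Q Z -> Q Y) ->
  (forall X, P X -> Q X) -> forall X, small_closure P X -> Q X.
Proof.
move=> Qret Q0 Qsum Qtri PQ X; elim=> {X} [X /PQ //|X /Q0 //|X Y Z XYZ _ QX _ QY||].
- exact: Qsum XYZ QX QY.
- by move=> X Y Z f g h /dist_tri d _ QX _ QZ; exact: Qtri d QX QZ.
- by move=> X Y /retract_summand XY _; exact: Qret.
Qed.

Lemma small_mono P Q : (forall X, P X -> small_closure Q X) ->
  forall X, small_closure P X -> small_closure Q X.
Proof.
apply: small_min => [X Y|X|X Y Z|X Y Z [f [g [h d]]]].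
- exact: small_retract.
- exact: small_zero.
- exact: small_sum.
- exact: small_ext d.
Qed.

Lemma small_rCoprod P X : small_closure P X -> rCoprod P X.
Proof.
move: X; apply: small_min => [X Y|X X0|X Y Z XYZ [X' PX' XX] [Y' PY' YY]|X Y Z|X PX].
- exact: rCoprod_retract.
- apply: Coprod_rCoprod.
  exact: Coprod_coproduct (coproduct_void (of_void _) X0) _.
- have [_ /(_ X' Y')[Z' XYZ']] := tcat_additive S.
  exists Z'; first by apply: Coprod_coproduct (biproduct_coproduct XYZ') _; case.
  apply: coproduct_retract (biproduct_coproduct XYZ) (biproduct_coproduct XYZ').
  by case.
- exact: rCoprod_tri.
- exact/Coprod_rCoprod/Coprod_base.
Qed.

Lemma small_cpt P : (forall X, P X -> cpt X) ->
  forall X, small_closure P X -> cpt X.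
Proof.
apply: small_min => [X Y|X X0|X Y Z|X Y Z].
- exact: cpt_retract.
- by move=> I F Y inj _ h; exists [::]; rewrite big_nil; exact: hom_from0.
- move=> [i [j [p [q [pi qj _ _ e]]]]] cX cY I F W inj Wcop h.
  have [s es] := cX _ _ _ _ Wcop (h \oc i).
  have [s' es'] := cY _ _ _ _ Wcop (h \oc j).
  exists ([seq Tagged (fun i => hom Z (F i)) (tagged x \oc p) | x <- s] ++
          [seq Tagged (fun i => hom Z (F i)) (tagged x \oc q) | x <- s']).
  rewrite big_cat !big_map /= -[h]compm1 -e compDr !compA es es' !comp_suml.
  by congr (_ + _); apply: eq_bigr => x _; rewrite compA.
- exact: cpt_tri.
Qed.

Definition factors P X Y (h : hom X Y) : Prop :=
  exists2 Z, P Z & exists (a : hom X Z) (b : hom Z Y), h = b \oc a.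

Lemma factors0 P X Y : factors (small_closure P) (0 : hom X Y).
Proof.
have [O O0] := zero_object_exists S.
by exists O; [exact: small_zero|exists 0, 0; rewrite comp0l].
Qed.

Lemma factors_compl P X Y Z (h : hom X Y) (k : hom Y Z) :
  factors P h -> factors P (k \oc h).
Proof.
by move=> [V PV [a [b ->]]]; exists V => //; exists a, (k \oc b); rewrite compA.
Qed.

Lemma factorsD P X Y (h k : hom X Y) : factors (small_closure P) h ->
  factors (small_closure P) k -> factors (small_closure P) (h + k).
Proof.
move=> [U PU [a [b ->]]] [V PV [a' [b' ->]]].
have [_ /(_ U V)[W UVW]] := tcat_additive S.
have [i [j [p [q [pi qj pj qi _]]]]] := UVW.
exists W; first exact: small_sum UVW PU PV.
exists (i \oc a + j \oc a'), (b \oc p + b' \oc q).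
rewrite compDl !compDr -!compA !(compA p) !(compA q) pi qj pj qi.
by rewrite !comp0l !comp0r !comp1m addr0 add0r.
Qed.

(** Factor c -> Y -> Z through a finitely built z. The cocone c' of c -> z is again compact and maps
    into X, through some finitely built x; this change of test object is why X is tested on all
    compact objects. The extension y of z by x induced by c' -> x then receives c, and c -> y -> Y
    differs from [h] by a map through z, hence through y. *)
Lemma factors_ext P c X Y Z : tri X Y Z -> (forall W, P W -> cpt W) ->
  (forall c', cpt c' -> forall k : hom c' X, factors (small_closure P) k) ->
  (forall k : hom c Z, factors (small_closure P) k) ->
  cpt c -> forall h : hom c Y, factors (small_closure P) h.
Proof.
move=> [f [g [t d]]] Pc PX PZ cc u.
have [z Pz [a [b e]]] := PZ (g \oc u).
have [c' [k [l dk]]] := dist_complete2 a.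
have cc' : cpt c'.
  have t' := tri_rot (tri_rot (dist_tri dk)).
  have /cpt_desusp := cpt_tri t' (small_cpt Pc Pz) (cpt_susp cc).
  by apply: cpt_retract; apply/isomorphic_retract/isomorphic_sym/suspK.
have [|v uk] := dist_factorl d (a := u \oc k).
  by rewrite compA e -compA (dist_comp0 dk) comp0r.
have [x Px [x1 [x2 ev]]] := PX _ cc' v.
(* [b] need not respect the connecting maps, so a filler takes its place. *)
have [b' [b1 b2]] := dist_fill dk d uk.
have [y [i [p dy]]] := dist_complete3 (fmap susp x1 \oc l).
have [|w [w1 w2]] := dist_fill13 dk dy (a := x1) (c := idm z).
  by rewrite compm1.
have [|y' [y1 y2]] := dist_fill13 dy d (a := x2) (c := b').
  by rewrite compA -fmap_comp -ev b2.
have [|r er] := dist_factorr dk (a := y' \oc w - u).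
  by rewrite compBl uk -compA w1 compA y1 -compA -ev subrr.
exists y; first exact: small_ext dy Px Pz.
exists w, (y' - r \oc p).
by rewrite compBl -(compA r) -w2 comp1m -er subKr.
Qed.

Lemma Coprod_factors P : (forall X, P X -> cpt X) -> forall Y, Coprod P Y ->
  forall c, cpt c -> forall h : hom c Y, factors (small_closure P) h.
Proof.
move=> Pc Y PY;
elim: PY => {Y} [X PX c|I F X inj _ IH Xcop c|
  X Y Z f g t /dist_tri d _ PX _ PZ c].
- move=> _ h; exists X; first exact: small_base.
  by exists h, (idm X); rewrite comp1m.
- move=> cc h; have [s ->] := cc _ _ _ _ Xcop h.
  apply: (big_ind (@factors (small_closure P) c X)) => [|k k'|x _].
  + exact: factors0.
  + exact: factorsD.
  + by apply: factors_compl; exact: IH.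
- by move=> cc; apply: (factors_ext d Pc PX _ cc) => k; exact: PZ.
Qed.

Lemma cpt_rCoprod_small P X : (forall Y, P Y -> cpt Y) -> cpt X ->
  rCoprod P X -> small_closure P X.
Proof.
move=> Pc cX [Y PY [i [p pi]]].
have [Z PZ [a [b e]]] := Coprod_factors Pc PY cX i.
by apply: small_retract PZ; exists a, (p \oc b); rewrite -compA -e.
Qed.

End Closures.

(** * Homotopy colimits *)

Section Generator.
Variables (S : triangulatedCategory) (G : S).
Hypothesis S_coproducts : has_coproducts S.
Hypothesis G_generator : compact_generator G.
Implicit Types (X Y Z W c : S) (P Q : S -> Prop) (n i j : int) (J K : int -> Prop).

Lemma generator_cpt : cpt G.
Proof. by case: G_generator => /is_compact_cpt. Qed.

(** The objects without nonzero maps to X are closed under coproducts, extensions and retracts, so X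
    is one of them. *)
Lemma generator_zero X : (forall i, hom_zero (shift G i) X) -> is_zero_object X.
Proof.
move=> GX; apply/zero_object_id; case: G_generator => _ /(_ X) [Y GY XY].
have : hom_zero X X.
  apply: (@rCoprod_hom_zerol _ (shifts G -oo%E +oo%E)) => [Z [i [_ ->]]|].
    exact: GX.
  by exists Y => //; exact/retract_summand.
exact.
Qed.

Lemma dist_mono_connecting X Y Z c c' (f : hom X Y) (g : hom Y Z)
    (h : hom Z (susp X)) (a : hom c Z) :
  dist f g h -> isomorphic (susp c') c ->
  (forall b : hom c' X, f \oc b = 0 -> b = 0) -> h \oc a = 0.
Proof.
move=> d [e ei] fmono; apply: (iso_cancelr ei); rewrite comp0l.
have [b eb] := susp_full (h \oc a \oc e); rewrite -eb.
rewrite (fmono b) ?fmap0 //; apply: susp_inj.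
by rewrite fmap_comp eb !compA (dist_susp_comp0 d) !comp0l fmap0.
Qed.

Lemma shift_susp_pred X i : isomorphic (susp (shift X (i - 1))) (shift X i).
Proof. by have := shiftS X (i - 1); rewrite subrK => /isomorphic_sym. Qed.

Lemma generator_detect_iso X Y (f : hom X Y) :
  (forall i (y : hom (shift G i) Y), exists x, y = f \oc x) ->
  (forall i (x : hom (shift G i) X), f \oc x = 0 -> x = 0) ->
  is_iso f.
Proof.
move=> fsurj finj; have [C [v [w d]]] := dist_cone f.
apply: (dist_zero_iso d); apply: generator_zero => i a.
have wa : w \oc a = 0.
  by apply: (dist_mono_connecting a d (shift_susp_pred G i)); exact: finj.
have [a' ->] := dist_factorl (dist_rot1 d) wa.
by have [x ->] := fsurj _ a'; rewrite compA (dist_comp0 d) comp0l.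
Qed.

Section Telescope.
Variables (E : nat -> S) (t : forall k, hom (E k) (E k.+1)).

Definition compatible W (u : forall k, hom (E k) W) : Prop :=
  forall k, u k.+1 \oc t k = u k.

(** The composite of transition maps is recorded only through its effect under compatible families,
    which spares transports along equalities of indices. *)
Lemma compatible_push c k m (y : hom c (E k)) : (k <= m)%N ->
  exists y' : hom c (E m), forall W (u : forall k, hom (E k) W),
    compatible u -> u m \oc y' = u k \oc y.
Proof.
move=> /subnKC <-; elim: (m - k)%N => [|n [y' y'P]].
  by rewrite addn0; exists y.
rewrite addnS; exists (t _ \oc y') => W u uc.
by rewrite compA uc y'P.
Qed.

Section Triangle.
Variables (X : S) (inj : forall k, hom (E k) X).
Hypothesis Xcop : is_coproduct inj.
Variable phi : hom X X.
Hypothesis phiE : forall k, phi \oc inj k = inj k - inj k.+1 \oc t k.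

(** [phi] is identity minus shift: its component k.+1 is [p k.+1 - t k \oc p k], so the components
    of [y] vanish successively, and compactness of [c] makes them determine [y]. *)
Lemma telescope_mono c (y : hom c X) : cpt c -> phi \oc y = 0 -> y = 0.
Proof.
move=> cc phiy; have [p [pi pj]] := coproduct_projections Xcop.
have p0 : p 0%N \oc phi = p 0%N.
  apply: (coproduct_ext Xcop) => j.
  by rewrite -compA phiE compBr compA (pj 0%N j.+1) // comp0l subr0.
have pS k : p k.+1 \oc phi = p k.+1 - t k \oc p k.
  apply: (coproduct_ext Xcop) => j.
  rewrite -compA phiE compBr compBl compA -(compA (t k)); congr (_ - _).
  have [<-|kj] := eqVneq k j; first by rewrite !pi comp1m compm1.
  by rewrite !pj // comp0l comp0r.
have py k : p k \oc y = 0.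
  elim: k => [|k IH]; first by rewrite -p0 -compA phiy comp0r.
  have : (p k.+1 \oc phi) \oc y = 0 by rewrite -compA phiy comp0r.
  by rewrite pS compBl -compA IH comp0r subr0.
have [s ->] := cpt_proj y Xcop pi pj cc.
by rewrite comp_suml big1 // => k _; rewrite -compA py comp0r.
Qed.

(** Maps [v] killing [phi] are those that factor through the homotopy colimit; modulo [phi], the
    finitely many components of [x] can be pushed to a common stage. *)
Lemma telescope_stage c (x : hom c X) : cpt c -> exists (k : nat) (y : hom c (E k)),
  forall W (v : hom X W), v \oc phi = 0 -> v \oc x = v \oc inj k \oc y.
Proof.
have vc W (v : hom X W) : v \oc phi = 0 -> compatible (fun k => v \oc inj k).
  move=> vphi k; apply/esym/eqP; rewrite -subr_eq0 -compA -compBr -phiE compA.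
  by rewrite vphi comp0l.
move=> cc; have [s ->] := cc _ _ _ _ Xcop x.
elim: s => [|[j z] s [k [y IH]]].
  by exists 0%N, 0 => W v _; rewrite big_nil !comp0r.
have [y1 y1P] := compatible_push y (leq_maxl k j).
have [y2 y2P] := compatible_push z (leq_maxr k j).
exists (maxn k j), (y2 + y1) => W v vphi.
rewrite big_cons !compDr IH // (y1P _ _ (vc _ _ vphi)) (y2P _ _ (vc _ _ vphi)).
by rewrite compA.
Qed.

End Triangle.

(** The comparison map from the cone of [phi] to F is bijective on maps from all shifts of G. The
    last hypothesis holds in particular if every [y] killed by [f k] dies at a later stage. *)
Lemma telescope X F (f : forall k, hom (E k) F) : coproduct E X -> compatible f ->
  (forall i (x : hom (shift G i) F), exists k y, x = f k \oc y) ->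
  (forall i k (y : hom (shift G i) (E k)), f k \oc y = 0 ->
    forall W (u : forall k, hom (E k) W), compatible u -> u k \oc y = 0) ->
  tri X X F.
Proof.
move=> [inj Xcop] fc fsurj finj.
have [phi phiE] := coproduct_desc Xcop (fun k => inj k - inj k.+1 \oc t k).
have [pi piE] := coproduct_desc Xcop f.
have [H [q [r d]]] := dist_cone phi.
have piphi : pi \oc phi = 0.
  apply: (coproduct_ext Xcop) => k.
  by rewrite comp0l -compA phiE compBr compA !piE fc subrr.
have [psi psiE] := dist_factorr d piphi.
have qc : compatible (fun k => q \oc inj k).
  move=> k; apply/esym/eqP; rewrite -subr_eq0 -compA -compBr -phiE compA.
  by rewrite (dist_comp0 d) comp0l.
have psii : is_iso psi.
  apply: generator_detect_iso => i x.
    have [k [y ->]] := fsurj _ x; exists (q \oc inj k \oc y).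
    by rewrite !compA -psiE piE.
  move=> psix.
  have rx : r \oc x = 0.
    apply: (dist_mono_connecting x d (shift_susp_pred G i)) => b.
    by apply: (telescope_mono Xcop phiE); exact/cpt_shift/generator_cpt.
  have [z xz] := dist_factorl (dist_rot1 d) rx.
  have [k [y zP]] := telescope_stage Xcop phiE z (cpt_shift (n := i) generator_cpt).
  rewrite xz zP ?(dist_comp0 d) //; apply: finj (qc).
  by rewrite -piE -zP // psiE -compA -xz.
apply: tri_iso (dist_tri d); try exact: isomorphic_refl.
by exists psi.
Qed.

End Telescope.

(* [X] is the telescope of the idempotent of [Y] that it splits. *)
Lemma Coprod_retract P X Y : (forall Z, P Z -> Coprod P (susp Z)) ->
  retract X Y -> Coprod P Y -> Coprod P X.
Proof.
move=> Psusp [i [p pi]] PY.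
have [W [inj Wcop]] := S_coproducts (fun _ : nat => Y).
have cW : coproduct (fun _ : nat => Y) W by exists inj.
have PW : Coprod P W by exact: Coprod_coproduct cW _.
have tW : tri W W X.
  apply: (@telescope (fun=> Y) (fun=> i \oc p) W X (fun=> p) cW)
    => [k|j x|j k y py V u uc].
  - by rewrite compA pi comp1m.
  - by exists 0%N, (i \oc x); rewrite compA pi comp1m.
  - by rewrite -uc -!compA py !comp0r.
(* X is an extension of W[1] by W, whence the need for stability under suspension. *)
exact: (Coprod_tri (tri_rot tW) PW (@Coprod_shift _ P P 1 Psusp W PW)).
Qed.

End Generator.

(** * Classes generated by a range of shifts *)

Section Gens.
Variable S : triangulatedCategory.
Hypothesis S_coproducts : has_coproducts S.
Implicit Types (X Y Z W G H : S) (P Q : S -> Prop) (n i j k : int)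
  (J K L : int -> Prop).

(** Indexed by the exponent of the shift, the opposite of the index used in [shifts], and by any set
    of exponents, so that comparing ranges is integer arithmetic. *)
Definition gens G J : S -> Prop := fun X => exists2 j, J j & X = shift G j.

Lemma gens_cpt G J X : cpt G -> gens G J X -> cpt X.
Proof. by move=> cG [j _ ->]; exact: cpt_shift. Qed.

Lemma Coprod_gens_shift G J K n X : (forall j, J j -> K (j + n)) ->
  Coprod (gens G J) X -> Coprod (gens G K) (shift X n).
Proof.
move=> JK; move: X; apply: Coprod_shift => _ [j Jj ->].
apply: Coprod_iso (isomorphic_sym (shiftD _ _ _)) _.
by apply: Coprod_base; exists (j + n) => //; exact: JK.
Qed.

Lemma rCoprod_gens_shift G J K n X : (forall j, J j -> K (j + n)) ->
  rCoprod (gens G J) X -> rCoprod (gens G K) (shift X n).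
Proof.
move=> JK [Y GY XY]; apply: rCoprod_retract (shift_retract n XY) _.
exact/Coprod_rCoprod/(Coprod_gens_shift JK).
Qed.

Lemma rCoprod_gens_mono G J K X : (forall j, J j -> K j) ->
  rCoprod (gens G J) X -> rCoprod (gens G K) X.
Proof.
move=> JK; move: X; apply: rCoprod_mono => // _ [j Jj ->].
by apply/Coprod_rCoprod/Coprod_base; exists j => //; exact: JK.
Qed.

Lemma rCoprod_gens_trans G H J K L X : rCoprod (gens G J) H ->
  (forall j k, J j -> K k -> L (j + k)) ->
  rCoprod (gens H K) X -> rCoprod (gens G L) X.
Proof.
move=> GH JKL; move: X; apply: rCoprod_mono => // _ [k Kk ->].
by apply: rCoprod_gens_shift GH => j Jj; exact: JKL.
Qed.

Lemma rCoprod_gens_hom_zero G H J K X Y : cpt G ->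
  (forall j k, J j -> K k -> hom_zero (shift G j) (shift H k)) ->
  rCoprod (gens G J) X -> rCoprod (gens H K) Y -> hom_zero X Y.
Proof.
move=> cG GH GX HY; move: X GX; apply: rCoprod_hom_zerol => _ [j Jj ->].
move: Y HY; apply: rCoprod_hom_zeror; first exact: cpt_shift.
by move=> _ [k Kk ->]; exact: GH.
Qed.

(** An upper half-line of exponents is stable under suspension, so [Coprod_retract] applies; aisles
    are the case in point. *)
Lemma Coprod_gens_retract G m X : compact_generator G ->
  rCoprod (gens G (fun j => m <= j)) X -> Coprod (gens G (fun j => m <= j)) X.
Proof.
move=> Ggen [Y GY XY]; apply: (Coprod_retract S_coproducts Ggen _ XY GY) => Z.
move=> /(@Coprod_base S) /(@Coprod_gens_shift G _ (fun j => m <= j) 1); apply=> j.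
lia.
Qed.

Lemma small_gens_bounded G J X : small_closure (gens G J) X ->
  exists m : nat, small_closure (gens G (fun j => J j /\ `|j| <= m%:Z)) X.
Proof.
have mono (m n : nat) Y : (m <= n)%N ->
    small_closure (gens G (fun j => J j /\ `|j| <= m%:Z)) Y ->
    small_closure (gens G (fun j => J j /\ `|j| <= n%:Z)) Y.
  move=> mn; move: Y; apply: small_mono => _ [j [Jj jm] ->].
  by apply: small_base; exists j => //; split=> //; lia.
move: X; apply: small_min => [X Y XY [m mY]|X X0|X Y Z XYZ [m mX] [n nY]|
  X Y Z t [m mX] [n nZ]|_ [j Jj ->]].
- by exists m; exact: small_retract XY mY.
- by exists 0%N; exact: small_zero.
- exists (maxn m n); apply: (small_sum XYZ).
    exact: mono (leq_maxl _ _) mX.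
  exact: mono (leq_maxr _ _) nY.
- exists (maxn m n); case: t => f [g [h d]]; apply: (small_ext d).
    exact: mono (leq_maxl _ _) mX.
  exact: mono (leq_maxr _ _) nZ.
- by exists `|j|%N; apply: small_base; exists j => //; split=> //; lia.
Qed.

Lemma gens_shifts G (A B : \bar int) X :
  shifts G A B X <-> gens G (fun j => (A <= (- j)%:E <= B)%E) X.
Proof.
split=> [[i [AB ->]]|[j AB ->]]; first by exists (- i) => //; rewrite opprK.
by exists (- j); rewrite opprK.
Qed.

Lemma Coprod_equiv P Q X : (forall Y, P Y <-> Q Y) -> Coprod P X <-> Coprod Q X.
Proof.
by move=> PQ; split; move: X; apply: Coprod_mono => X /PQ; exact: Coprod_base.
Qed.

Lemma big_genE G (A B : \bar int) X :
  big_gen G A B X <-> rCoprod (gens G (fun j => (A <= (- j)%:E <= B)%E)) X.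
Proof.
split=> [[Y GY XY]|[Y GY XY]].
  exists Y; last exact/retract_summand.
  by apply/(Coprod_equiv Y (gens_shifts G A B)).
exists Y; last exact/retract_summand.
by apply/(Coprod_equiv Y (gens_shifts G A B)).
Qed.

Lemma big_gen_between G (m n : int) X :
  big_gen G m%:E n%:E X <-> rCoprod (gens G (fun j => - n <= j <= - m)) X.
Proof.
apply: iff_trans (big_genE _ _ _ _) _.
by split; apply: rCoprod_gens_mono => j; rewrite !lee_fin; lia.
Qed.

Lemma gen_le0E G X : gen_le0 G X <-> Coprod (gens G (fun j => 0 <= j)) X.
Proof.
apply: iff_trans (Coprod_equiv _ (gens_shifts _ _ _)) _.
split; move: X; apply: Coprod_mono => _ [j Jj ->]; apply: Coprod_base; exists j => //.
  by move: Jj; rewrite !lee_fin; lia.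
by rewrite leNye !lee_fin; lia.
Qed.

(** Being compact and a retract of an object built from all shifts of G, X is finitely built, and a
    finite construction uses only a bounded range. This compares any two compact generators. *)
Lemma cpt_gens G X : compact_generator G -> cpt X ->
  exists m : nat, rCoprod (gens G (fun j => `|j| <= m%:Z)) X.
Proof.
move=> Ggen cX; have cG := generator_cpt Ggen.
have [|m mX] := @small_gens_bounded G (fun=> True) X.
  apply: cpt_rCoprod_small cX _; first by move=> Y; exact: gens_cpt.
  case: Ggen => _ /(_ X) /big_genE; exact: rCoprod_gens_mono.
by exists m; move/small_rCoprod: mX; apply: rCoprod_gens_mono => j [].
Qed.

Lemma gen_le0_shift G X n : 0 <= n -> gen_le0 G X -> gen_le0 G (shift X n).
Proof.
by move=> n0 /gen_le0E GX; apply/gen_le0E; apply: Coprod_gens_shift GX; lia.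
Qed.

End Gens.

(** * Iterated approximations *)

Section Approximation.
Variable S : triangulatedCategory.
Hypothesis S_coproducts : has_coproducts S.
Variables (H : S) (L : S -> Prop) (A : int).
Hypothesis A_ge0 : 0 <= A.
Hypothesis L_approx : forall F, L F ->
  approximated (rCoprod (gens H (fun j => - A <= j <= A))) (shift_class L 1) F.
Implicit Types (E F D : S).

(** Step k adds exponents from k - A to k + A: the lower end never moves, and the strict upper bound
    encodes that k steps reach only A + k - 1. *)
Definition stage (F : S) (k : nat) (E : S) (f : hom E F) : Prop :=
  rCoprod (gens H (fun j => - A <= j < A + k%:Z)) E /\
  exists (D : S) (g : hom F D) (h : hom D (susp E)),
    dist f g h /\ shift_class L k%:Z D.

Lemma stage0 F : L F -> exists (E : S) (f : hom E F), stage 0 f.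
Proof.
move=> LF; have [O O0] := zero_object_exists S.
exists O, 0; split.
  exact/small_rCoprod/small_zero.
exists F, (idm F), 0; split; first exact: dist_id_right.
by exists F => //; exact: isomorphic_refl.
Qed.

Lemma stageS F k E (f : hom E F) : stage k f ->
  exists (E' : S) (f' : hom E' F), stage k.+1 f' /\
    exists a : hom E E', f' \oc a = f.
Proof.
move=> [HE [D [g [h [d [D0 LD0 DD0]]]]]].
have [E1 [D1 [u [v [w [d1 HE1 [D2 LD2 D12]]]]]]] := L_approx LD0.
have [u' [v' [w' d']]] : tri (shift E1 k%:Z) D (shift D1 k%:Z).
  apply: tri_iso (shift_tri k%:Z (dist_tri d1)); try exact: isomorphic_refl.
  exact: isomorphic_sym.
have [E' [f' [l [a [df' fa t]]]]] := dist_cocone_comp d d'.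
exists E', f'; split; last by exists a.
split.
  apply: rCoprod_tri t _ _; first by apply: rCoprod_gens_mono HE => // j; lia.
  by apply: rCoprod_gens_shift HE1 => j; lia.
exists (shift D1 k%:Z), (v' \oc g), l; split=> //.
exists D2 => //; apply: isomorphic_trans (shift_isomorphic k%:Z D12) _.
by apply: shift_eq; lia.
Qed.

Lemma approximation_iter F (k : nat) : L F ->
  approximated (rCoprod (gens H (fun j => - A <= j < A + k%:Z)))
    (shift_class L k%:Z) F.
Proof.
move=> LF; have [E [f [HE [D [g [h [d LD]]]]]]] : exists E (f : hom E F), stage k f.
  elim: k => [|k [E [f /stageS[E' [f' [fk _]]]]]]; first exact: stage0.
  by exists E', f'.
by exists E, D, f, g, h.
Qed.

Lemma approximation_tower F : L F ->
  exists (E : nat -> S) (t : forall k, hom (E k) (E k.+1))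
    (f : forall k, hom (E k) F), compatible t f /\ forall k, stage k (f k).
Proof.
move=> LF.
(* Consecutive stages must be linked by transition maps, so the stages are chosen recursively, each
   from the previous one. *)
pose T k := {E : S & {f : hom E F | stage k f}}.
have s0 : T 0%N.
  by have /cid[E /cid[f fs]] := stage0 LF; exists E, f.
have step k (s : T k) : {s' : T k.+1 & {a : hom (tag s) (tag s') |
    sval (tagged s') \oc a = sval (tagged s)}}.
  case: s => E [f fs] /=; have /cid[E' /cid[f' [fs' /cid[a fa]]]] := stageS fs.
  by exists (existT _ E' (exist _ f' fs')), a.
pose s := fix s k : T k := if k is k.+1 then tag (step k (s k)) else s0.
exists (fun k => tag (s k)), (fun k => sval (tagged (step k (s k)))).
exists (fun k => sval (tagged (s k))); split=> k.
  exact: (svalP (tagged (step k (s k)))).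
exact: (svalP (tagged (s k))).
Qed.

End Approximation.

(** * Weak approximability *)

Section WeaklyApproximable.
Variable S : triangulatedCategory.
Hypothesis S_coproducts : has_coproducts S.
Variables (H : S) (le0 ge1 : S -> Prop) (A : int).
Hypothesis H_generator : compact_generator H.
Hypothesis tstr : is_tstructure le0 ge1.
Hypothesis A_gt0 : 0 < A.
Hypothesis H_le0 : le0 (shift H A).
Hypothesis H_left : forall X, le0 X -> hom_zero (shift H (- A)) X.
Hypothesis H_approx : forall F, le0 F ->
  approximated (big_gen H (- A)%:E A%:E) (shift_class le0 1) F.
Implicit Types (E F D G X Y : S).

(** If X -> V vanishes in the truncation triangle, the identity of V factors through U[1], so V = 0.
    As a left orthogonal, the aisle inherits closure under coproducts, extensions and retracts. *)
Lemma le0P X : le0 X <-> forall Y, ge1 Y -> hom_zero X Y.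
Proof.
have [[le0_iso _] le0_susp _ le0_ge1 trunc] := tstr.
split=> [lX Y|XY]; first exact: le0_ge1.
have [U [V [f [g [h [d lU gV]]]]]] := trunc X.
have [|c ec] := dist_factorr (dist_rot1 d) (a := idm V).
  by rewrite (XY V gV g) comp0r.
have V0 : is_zero_object V.
  by apply/zero_object_id; rewrite ec (le0_ge1 _ _ (le0_susp _ lU) gV c) comp0l.
by apply: le0_iso lU; exists f; exact: dist_zero_iso d V0.
Qed.

Lemma le0_rCoprod P X : (forall Y, P Y -> le0 Y) -> rCoprod P X -> le0 X.
Proof.
move=> PX rX; apply/le0P => Y gY; move: X rX; apply: rCoprod_hom_zerol.
by move=> X /PX/le0P; apply.
Qed.

Lemma le0_iso X Y : isomorphic X Y -> le0 X -> le0 Y.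
Proof. by case: tstr => -[h _] _ _ _ _; exact: h. Qed.

Lemma le0_shift X n : 0 <= n -> le0 X -> le0 (shift X n).
Proof.
case: tstr => _ le0_susp _ _ _.
by case: n => // n _ lX /=; elim: n => [|n IH] //=; exact: le0_susp.
Qed.

Lemma gens_le0 j : A <= j -> le0 (shift H j).
Proof.
move=> Aj; apply: (@le0_iso (shift (shift H A) (j - A))).
  by apply: shift_eq; lia.
by apply: le0_shift H_le0; lia.
Qed.

Lemma hom_zero_le0 i n X : le0 X -> i + A <= n ->
  hom_zero (shift H i) (shift X n).
Proof.
move=> lX iAn; apply: (@hom_zero_shift _ _ _ (- A) (n - i - A)); first by lia.
by apply/H_left/le0_shift => //; lia.
Qed.

Lemma le0_approximated F : le0 F ->
  approximated (rCoprod (gens H (fun j => - A <= j <= A))) (shift_class le0 1) F.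
Proof.
move=> /H_approx[E [D [f [g [h [d HE lD]]]]]]; exists E, D, f, g, h; split=> //.
by move/(big_gen_between S_coproducts): HE; rewrite opprK.
Qed.

(** The lower end [- A] is common to all stages and so survives the homotopy colimit. The telescope
    criterion holds because H[i] has no maps to a remainder at a stage from i + A on. *)
Lemma le0_Coprod F : le0 F -> Coprod (gens H (fun j => - A <= j)) F.
Proof.
move=> lF; have A0 : 0 <= A by lia.
have [E [t [f [fc fs]]]] := approximation_tower S_coproducts A0 le0_approximated lF.
have hom0 i k D : shift_class le0 k D -> i + A <= k -> hom_zero (shift H i) D.
  move=> [D' lD' DD'] ik; apply: hom_zero_iso (hom_zero_le0 lD' ik).
    exact: isomorphic_refl.
  exact: isomorphic_sym.
have [W [inj Wcop]] := S_coproducts E.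
have cW : coproduct E W by exists inj.
have tW : tri W W F.
  apply: (telescope H_generator cW fc) => [i x|i k y fy V u uc].
    have [_ [D [g [h [d lD]]]]] := fs (absz (i + A)).
    have [|y ->] := dist_factorl d (a := x); last by exists (absz (i + A)), y.
    by apply: (hom0 _ _ _ lD); lia.
  (* One further than for surjectivity: what H[i] loses in E -> F comes from maps H[i + 1] -> D. *)
  pose m := maxn k (absz (i + 1 + A)).
  have [y' y'P] := compatible_push t y (leq_maxl k (absz (i + 1 + A))).
  have [_ [D [g [h [d lD]]]]] := fs m.
  rewrite -(y'P _ u uc) (_ : y' = 0) ?comp0r //; apply: susp_inj.
  have [|b ->] := dist_susp_factorl d (a := y').
    by rewrite (y'P _ f fc).
  suff -> : b = 0 by rewrite comp0r fmap0.
  apply: (hom_zero_iso (shiftS H i) (isomorphic_refl D)).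
  by apply: (hom0 _ _ _ lD); rewrite /m; lia.
have HW : rCoprod (gens H (fun j => - A <= j)) W.
  apply: rCoprod_coproduct cW _ => // k; have [HE _] := fs k.
  by apply: rCoprod_gens_mono HE => // j; lia.
apply: (Coprod_gens_retract S_coproducts H_generator).
apply: (rCoprod_tri (tri_rot tW) HW).
by apply: (@rCoprod_gens_shift _ _ _ _ 1 W _ HW) => j; lia.
Qed.

Section OtherGenerator.
Variable G : S.
Hypothesis G_generator : compact_generator G.

Lemma gen_le0_le0 : exists2 m : int, 0 <= m & forall X, gen_le0 G X -> le0 (shift X m).
Proof.
have [m mG] := cpt_gens S_coproducts H_generator (generator_cpt G_generator).
(* The exponents of [H] in [G] are at least [- m], and those from [A] on lie in the aisle. *)
exists (m%:Z + A) => [|X /gen_le0E GX]; first by lia.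
apply: (@le0_rCoprod (gens G (fun j => m%:Z + A <= j))) => [_ [j jm ->]|].
  apply: (@le0_rCoprod (gens H (fun j => A <= j))) => [_ [k /gens_le0 lk -> //]|].
  by apply: rCoprod_gens_shift mG => k; lia.
by apply/Coprod_rCoprod; apply: Coprod_gens_shift GX; lia.
Qed.

Lemma le0_gen_le0 : exists2 m : int, 0 <= m & forall X, le0 X -> gen_le0 G (shift X m).
Proof.
have [m mH] := cpt_gens S_coproducts G_generator (generator_cpt H_generator).
exists (m%:Z + A) => [|X /le0_Coprod HX]; first by lia.
have GX : Coprod (gens G (fun j => - A - m%:Z <= j)) X.
  apply: (Coprod_gens_retract S_coproducts G_generator).
  apply: (rCoprod_gens_trans S_coproducts mH _ (Coprod_rCoprod HX)).
  by move=> j k; lia.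
by apply/gen_le0E; apply: Coprod_gens_shift GX => j; lia.
Qed.

Lemma generator_hom_bounded :
  exists c : nat, forall i : int, c%:Z < i -> hom_zero G (shift G i).
Proof.
have [m mG] := cpt_gens S_coproducts H_generator (generator_cpt G_generator).
(* One [m] for each copy of [G] written in shifts of [H], and A + A because Hom(H, H[n]) = 0 for n
   >= A + A. *)
exists (m + m + absz (A + A)%R)%N => i ci.
have iG : rCoprod (gens H (fun j => i - m%:Z <= j)) (shift G i).
  by apply: rCoprod_gens_shift mG => k; lia.
apply: (rCoprod_gens_hom_zero (generator_cpt H_generator) _ mG iG) => j k jm ki.
apply: (@hom_zero_shift _ _ _ j (k - A + A)); first by lia.
have lA := gens_le0 (lexx A).
apply: (@hom_zero_iso _ _ _ (shift (shift H A) (k - A))).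
- exact: isomorphic_refl.
- by apply: shift_eq; lia.
by apply: hom_zero_le0 lA _; lia.
Qed.

Lemma gen_le0_approximated : exists n : nat, forall M, gen_le0 G M ->
  approximated (big_gen G (- n%:Z)%:E n%:Z%:E) (gen_le G (- 1)) M.
Proof.
have [m mH] := cpt_gens S_coproducts G_generator (generator_cpt H_generator).
have [p p0 gl] := gen_le0_le0; have [q q0 lg] := le0_gen_le0.
(* Depth [p] is spent entering the given aisle, [q] returning to the aisle of [G], and 1 is the
   depth required of the remainder. *)
pose k := absz (p + q + 1).
exists (m + `|A| + k + `|p|)%N => M /gl lM.
have A0 : 0 <= A by lia.
have [E [D [f [g [h [d HE lD]]]]]] :=
  approximation_iter S_coproducts A0 le0_approximated k lM.
have [f' [g' [h' d']]] : tri (shift E (- p)) M (shift D (- p)).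
  apply: tri_iso (shift_tri (- p) (dist_tri d)); try exact: isomorphic_refl.
  exact: shiftK.
exists (shift E (- p)), (shift D (- p)), f', g', h'; split=> //.
  apply/(big_gen_between S_coproducts).
  have GE := rCoprod_gens_trans
    (L := fun j => - A - m%:Z <= j <= A + k%:Z + m%:Z) S_coproducts mH _ HE.
  by apply: rCoprod_gens_shift (GE _) => j; lia.
have [D' lD' DD'] := lD; exists (shift D' (k%:Z - 1 - p)).
  apply: (Coprod_iso (X := shift (shift D' q) (k%:Z - 1 - p - q))).
    by apply: shift_eq; lia.
  by apply: gen_le0_shift (lg _ lD'); lia.
apply: isomorphic_trans (shift_isomorphic _ DD') _.
apply: isomorphic_trans (shiftD _ _ _) _; apply: isomorphic_sym.
by apply: shift_eq; lia.
Qed.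

End OtherGenerator.

End WeaklyApproximable.

(** * Finitistic dimensions *)

Section ExtendedIntegers.
Implicit Types (A : set (\bar int)) (x y : \bar int) (d : int).

(** A set with an integer element and an integer lower bound [m] has a least element, by
    well-ordering of the distances to [m]; otherwise an infinite value serves. As [infimum] chooses
    a greatest lower bound, its order properties rest on this existence. *)
Lemma infimums_nonempty A : infimums A !=set0.
Proof.
have [[m mA]|nolb] := pselect (exists m : int, lbound A m%:E); last first.
  exists -oo%E; split=> [x _|y yA]; first exact: leNye.
  case: y yA => [r rA|ooA|//]; first by case: nolb; exists r.
  by case: nolb; exists 0 => x /ooA; apply: le_trans; exact: leey.
have [[z Az]|noint] := pselect (exists z : int, A z%:E); last first.
  exists +oo%E; split=> [x Ax|y _]; last exact: leey.
  case: x Ax => [r Ar||Aoo]; [by case: noint; exists r|by []|].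
  by have := mA _ Aoo; rewrite leeNy_eq.
have zm : m <= z by have := mA _ Az; rewrite lee_fin.
have ex : exists k : nat, `[< A (m + k%:Z)%:E >].
  exists (absz (z - m)); apply/asboolP.
  by have -> : m + (absz (z - m))%:Z = z by lia.
exists (m + (ex_minn ex)%:Z)%:E; case: ex_minnP => k /asboolP Ak kmin.
split=> [x Ax|y]; last by apply.
case: x Ax => [r Ar||Aoo]; [|by rewrite leey|by have := mA _ Aoo; rewrite leeNy_eq].
have mr : m <= r by have := mA _ Ar; rewrite lee_fin.
rewrite lee_fin; have := kmin (absz (r - m)).
have -> : m + (absz (r - m))%:Z = r by lia.
by move=> /(_ (asboolT Ar)); lia.
Qed.

Lemma ge_infimum A x : A x -> (infimum +oo%E A <= x)%E.
Proof. exact/le_infimum_Nmem/infimums_nonempty. Qed.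

Lemma le_infimum A y : lbound A y -> (y <= infimum +oo%E A)%E.
Proof.
move=> yA; rewrite /infimum; case: ifPn => _; first exact: leey.
have [z Az] := infimums_nonempty A.
by case: xgetP => [w _ [_]|/(_ z) //]; exact.
Qed.

(** Discreteness: otherwise d + 1 would be a lower bound. *)
Lemma infimum_le_fin A d : (infimum +oo%E A <= d%:E)%E ->
  exists2 x, A x & (x <= d%:E)%E.
Proof.
move=> Ad; apply: contrapT => noA.
suff /le_trans/(_ Ad) : ((d + 1)%:E <= infimum +oo%E A)%E by rewrite lee_fin; lia.
apply: le_infimum => x Ax; case: x Ax => [r Ar||Aoo].
- rewrite lee_fin leNgt; apply/negP => rd; apply: noA; exists r%:E => //.
  by rewrite lee_fin; lia.
- by rewrite leey.
- by case: noA; exists -oo%E => //; exact: leNye.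
Qed.

Lemma supremums_nonempty A : supremums A !=set0.
Proof.
have [z [zlb zglb]] := infimums_nonempty (ubound A).
by exists z; split=> // x Ax; apply: zglb => y; exact.
Qed.

Lemma le_supremum A x : A x -> (x <= supremum -oo%E A)%E.
Proof. exact/ge_supremum_Nmem/supremums_nonempty. Qed.

Lemma ge_supremum A y : ubound A y -> (supremum -oo%E A <= y)%E.
Proof.
move=> yA; rewrite /supremum; case: ifPn => _; first exact: leNye.
have [z Az] := supremums_nonempty A.
by case: xgetP => [w _ [_]|/(_ z) //]; exact.
Qed.

End ExtendedIntegers.

(** * The two inequalities in terms of explicit bounds *)

Section Finitistic.
Variables (S : triangulatedCategory) (G : S).
Hypothesis S_coproducts : has_coproducts S.
Hypothesis G_generator : compact_generator G.
Implicit Types (X Y E D : S).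

Let G_cpt : cpt G := generator_cpt G_generator.

Lemma gen_boundedP Y : gen_bounded G Y <->
  (exists n : int, gen_le0 G (shift Y n)) /\
  (exists n : int, forall i : int, n <= i -> hom_zero (shift G i) Y).
Proof.
split=> [[n [Yle Yge]]|[[n Yle] [m Yge]]].
  split; first by exists n.
  exists n%:Z => i ni; apply: (@hom_zero_shift _ _ _ (i - n%:Z) (- n%:Z) i 0).
    by lia.
  by apply: Yge; lia.
exists (absz n + absz m)%N; split.
  apply: (Coprod_iso (X := shift (shift Y n) ((absz n + absz m)%:Z - n))).
    by apply: shift_eq; lia.
  by apply: gen_le0_shift Yle; lia.
move=> i i0; apply: (@hom_zero_shift _ _ _ (i + (absz n + absz m)%:Z) 0).
  by lia.
by apply: Yge; lia.
Qed.

Lemma gen_bounded_shift Y Z n : isomorphic Z (shift Y n) ->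
  gen_bounded G Z -> gen_bounded G Y.
Proof.
move=> ZY /gen_boundedP[[p Zle] [q Zge]]; apply/gen_boundedP; split.
  exists (n + p); apply: Coprod_iso Zle.
  by apply: isomorphic_trans (shift_isomorphic p ZY) _; exact: shiftD.
exists (q - n) => i qi; apply: (@hom_zero_shift _ _ _ (i + n) n i 0).
  by lia.
apply: (hom_zero_iso (isomorphic_refl _) ZY); apply: Zge; lia.
Qed.

Lemma gen_ge0P X :
  gen_ge G 0 X <-> forall m : int, 1 <= m -> hom_zero (shift G m) X.
Proof.
split=> [[Y Yge XY] m m1|Xge].
  apply: hom_zero_iso (isomorphic_refl _) (isomorphic_sym XY) _.
  apply: (@hom_zero_shift _ _ _ (m - 1) 0); first by lia.
  by apply: Yge; lia.
exists (shift X (- 1)).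
  move=> i i0; apply: (@hom_zero_shift _ _ _ (i + 1) 0); first by lia.
  by apply: Xge; lia.
by apply: isomorphic_sym; apply: shift_eq (_ : _ = 0).
Qed.

Lemma small_gen_rCoprod X n : shift_class (small_gen G 0%:E +oo%E) n X ->
  rCoprod (gens G (fun j => j <= n)) X.
Proof.
move=> [Y /small_rCoprod GY XY].
apply: rCoprod_iso_closed (isomorphic_sym XY) _.
apply: (@rCoprod_gens_shift _ _ (fun j => j <= 0)) => [j|]; first by lia.
move: Y GY {XY}; apply: rCoprod_mono => // _ /gens_shifts[j j0 ->].
apply/Coprod_rCoprod/Coprod_base; exists j => //.
by move: j0; rewrite leey andbT lee_fin; lia.
Qed.

Section Bounds.
Variable c : nat.
Hypothesis G_hom_above : forall i : int, c%:Z < i -> hom_zero G (shift G i).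

Lemma rCoprod_hom_above n X Y i : rCoprod (gens G (fun j => j <= n)) X ->
  gen_le0 G Y -> n + c%:Z < i -> hom_zero X (shift Y i).
Proof.
move=> GX /gen_le0E GY ni.
have GYi : rCoprod (gens G (fun j => i <= j)) (shift Y i).
  by apply/Coprod_rCoprod; apply: Coprod_gens_shift GY => j; lia.
apply: (rCoprod_gens_hom_zero G_cpt _ GX GYi) => j k jn ik.
by apply: (@hom_zero_shift _ _ _ 0 (k - j)); [lia|apply: G_hom_above; lia].
Qed.

Lemma cpt_pd_lt_oo X : cpt X -> (pd G X < +oo)%E.
Proof.
move=> /(cpt_gens S_coproducts G_generator)[m mX].
have GX : rCoprod (gens G (fun j => j <= m%:Z)) X.
  by apply: rCoprod_gens_mono mX => // j; lia.
apply: (@le_lt_trans _ _ (m%:Z + c%:Z)%:E); last exact: ltry.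
apply: ge_infimum; exists (m%:Z + c%:Z) => // i Y mi _ Yle.
exact: rCoprod_hom_above GX Yle mi.
Qed.

Lemma fpd_le n :
  (forall X, is_compact X -> (forall m : int, 1 <= m -> hom_zero (shift G m) X) ->
    shift_class (small_gen G 0%:E +oo%E) n%:Z X) ->
  (fpd G <= (n%:Z + c%:Z)%:E)%E.
Proof.
move=> Gn; apply: ge_supremum => _ [X [[Xc _ /gen_ge0P Xge _] ->]].
apply: ge_infimum; exists (n%:Z + c%:Z) => // i Y ni _ Yle.
exact: rCoprod_hom_above (small_gen_rCoprod (Gn _ Xc Xge)) Yle ni.
Qed.

Variables (N : int) (a : nat).
Hypothesis G_hom_below : forall i : int, i < N -> hom_zero G (shift G i).
Hypothesis G_approx : forall M, gen_le0 G M ->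
  approximated (big_gen G (- a%:Z)%:E a%:Z%:E) (gen_le G (- 1)) M.

Lemma cpt_gen_bounded X : cpt X ->
  (forall m : int, 1 <= m -> hom_zero (shift G m) X) -> gen_bounded G X.
Proof.
move=> /(cpt_gens S_coproducts G_generator)[m mX] Xge.
apply/gen_boundedP; split; last by exists 1.
exists m%:Z; apply/gen_le0E/(Coprod_gens_retract S_coproducts G_generator).
by apply: rCoprod_gens_shift mX => j; lia.
Qed.

(** Maps G[i] -> D are controlled by X, which is bounded, and by E[1]. Although E may involve
    infinite coproducts, compactness of G reduces the latter to Hom(G[i], G[j]) with j <= n + 1,
    zero for large i. *)
Lemma gen_bounded_cone E X D m n : tri E X D ->
  rCoprod (gens G (fun j => j <= n)) E -> gen_bounded G X ->
  gen_le0 G (shift D m) -> gen_bounded G D.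
Proof.
move=> t GE /gen_boundedP[_ [q Xge]] Dle; apply/gen_boundedP; split.
  by exists m.
(* For j <= n + 1 this forces j - i <= N - 1. *)
exists (`|q| + `|n + 2 - N|) => i qi.
apply: (hom_zero_trir (tri_rot t)); first by apply: Xge; lia.
have GE1 : rCoprod (gens G (fun j => j <= n + 1)) (shift E 1).
  by apply: rCoprod_gens_shift GE => j; lia.
apply: (rCoprod_hom_zeror (cpt_shift G_cpt) _ GE1) => _ [j jn ->].
by apply: (@hom_zero_shift _ _ _ 0 (j - i)); [lia|apply: G_hom_below; lia].
Qed.

Lemma cpt_small_gen X d (n : nat) : cpt X ->
  (forall m : int, 1 <= m -> hom_zero (shift G m) X) ->
  (pd G X <= d%:E)%E -> d + a%:Z <= n%:Z ->
  shift_class (small_gen G 0%:E +oo%E) n%:Z X.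
Proof.
move=> cX Xge Xpd dan; have Xb := cpt_gen_bounded cX Xge.
have [_ [n0 n0P <-]] := infimum_le_fin Xpd; rewrite lee_fin => n0d.
have [[m Xm] _] := (gen_boundedP X).1 Xb.

have a0 : 0 <= a%:Z by [].
have approx F : gen_le0 G F -> approximated
    (rCoprod (gens G (fun j => - a%:Z <= j <= a%:Z))) (shift_class (gen_le0 G) 1) F.
  move=> /G_approx[E [D [f [g [h [dd GE Dle]]]]]]; exists E, D, f, g, h; split=> //.
  by move/(big_gen_between S_coproducts): GE; rewrite opprK.
(* The first entry puts X[q] into the aisle; the second makes q + d + 1 positive even for negative
   [d], so that [absz] in [k] changes nothing. *)
pose q := maxn `|m|%N (absz (1 - d)).
pose k := absz (q%:Z + d + 1).
have Xq : gen_le0 G (shift X q%:Z).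
  apply: (Coprod_iso (X := shift (shift X m) (q%:Z - m))).
    by apply: shift_eq; rewrite /q; lia.
  by apply: gen_le0_shift Xm; rewrite /q; lia.
have [E0 [D0 [f0 [g0 [h0 [dd GE0 [D Dle D0D]]]]]]] :=
  approximation_iter S_coproducts a0 approx k Xq.
have [f [g [h dE]]] : tri (shift E0 (- q%:Z)) X (shift D (d + 1)).
  apply: tri_iso (shift_tri (- q%:Z) (dist_tri dd)).
  - exact: isomorphic_refl.
  - exact: shiftK.
  - apply: isomorphic_trans (shift_isomorphic _ D0D) _.
    by apply: shift_eq; rewrite /k /q; lia.
have GE : rCoprod (gens G (fun j => j <= d + a%:Z)) (shift E0 (- q%:Z)).
  by apply: rCoprod_gens_shift GE0 => j; rewrite /k /q; lia.
have Db : gen_bounded G D.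
  apply: (gen_bounded_shift (isomorphic_refl _)).
  apply: (gen_bounded_cone (m := - (d + 1)) (dist_tri dE) GE Xb).
  by apply: Coprod_iso Dle; apply: isomorphic_sym; exact: shiftK.
(* The target is D[d + 1] with D bounded and in the aisle, and n0 <= d. *)
have g_eq0 : g = 0 by apply: n0P Db Dle _; lia.
have [|s Xs] := dist_factorl dE (a := idm X); first by rewrite g_eq0 comp0l.
have XE : retract X (shift E0 (- q%:Z)) by exists s, f.
have Xn : small_closure (gens G (fun j => j <= 0)) (shift X (- n%:Z)).
  apply: cpt_rCoprod_small; first by move=> Y; exact: gens_cpt.
    exact: cpt_shift.
  apply: rCoprod_retract (shift_retract (- n%:Z) XE) _.
  apply: rCoprod_gens_shift GE => j; lia.
exists (shift X (- n%:Z)).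
  move: Xn; apply: small_mono => _ [j j0 ->]; apply: small_base.
  apply/gens_shifts; exists j => //.
  by rewrite leey andbT lee_fin; lia.
by apply: isomorphic_sym; apply: shift_eq (_ : _ = 0); lia.
Qed.

End Bounds.
End Finitistic.

(** * Finiteness of the invariants and the theorem *)

Lemma nat_infimum_ge0 (P : set nat) :
  (0%:E <= infimum +oo%E [set (n%:Z)%:E | n in P])%E.
Proof. by apply: le_infimum => _ [n _ <-]; rewrite lee_fin. Qed.

Lemma nat_infimum_fin (P : set nat) :
  (infimum +oo%E [set (n%:Z)%:E | n in P] < +oo)%E ->
  exists2 n : nat, P n & infimum +oo%E [set (n%:Z)%:E | n in P] = (n%:Z)%:E.
Proof.
set A := image _ _; move=> Aoo.
case EA : (infimum +oo%E A) Aoo => [r||] // _; last first.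
  by have := nat_infimum_ge0 P; rewrite -/A EA leeNy_eq.
have [|_ [n Pn <-] nr] := @infimum_le_fin A r; first by rewrite EA.
exists n => //; apply/le_anti; rewrite nr andbT -EA.
by apply: ge_infimum; exists n.
Qed.

Lemma approximated_mono (S : triangulatedCategory) (G M : S) (Q : S -> Prop)
    (m n : nat) : has_coproducts S -> (m <= n)%N ->
  approximated (big_gen G (- m%:Z)%:E m%:Z%:E) Q M ->
  approximated (big_gen G (- n%:Z)%:E n%:Z%:E) Q M.
Proof.
move=> Scop mn [E [D [f [g [h [d GE QD]]]]]]; exists E, D, f, g, h; split=> //.
move: GE => /(big_gen_between Scop) GE; apply/(big_gen_between Scop).
by apply: rCoprod_gens_mono GE => // j; lia.
Qed.

(** The bound [n] excludes +oo and the zero object, which lies in the aisle, excludes -oo. Each M is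
    approximated within its own range, which is then enlarged to the common one. *)
Lemma approx_index_fin (S : triangulatedCategory) (G : S) (n : nat) :
  has_coproducts S ->
  (forall M, gen_le0 G M ->
    approximated (big_gen G (- n%:Z)%:E n%:Z%:E) (gen_le G (- 1)) M) ->
  exists2 a : nat, approx_index G = a%:Z%:E & forall M, gen_le0 G M ->
    approximated (big_gen G (- a%:Z)%:E a%:Z%:E) (gen_le G (- 1)) M.
Proof.
move=> Scop Gn.
have bound M : gen_le0 G M -> (approx_bound G M <= n%:Z%:E)%E.
  by move=> /Gn Mn; apply: ge_infimum; exists n.
have an : (approx_index G <= n%:Z%:E)%E.
  by apply: ge_supremum => _ [M [/bound Mn ->]].
have [O O0] := zero_object_exists S.
have GO : gen_le0 G O.
  exact: Coprod_coproduct (coproduct_void (of_void _) O0) _.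
have a0 : (0%:E <= approx_index G)%E.
  apply: le_trans (nat_infimum_ge0 _) (le_supremum _).
  by exists O.
case Ea : (approx_index G) an a0 => [r||] //; rewrite lee_fin => _ r0.
exists (absz r); first by congr (_%:E); rewrite lee_fin in r0; lia.
move=> M GM; have Mr : (approx_bound G M <= r%:E)%E.
  by rewrite -Ea; apply: le_supremum; exists M.
have [_ [m Mm <-]] := infimum_le_fin Mr; rewrite lee_fin => mr.
by apply: approximated_mono Mm => //; lia.
Qed.

Local Open Scope ereal_scope.

Theorem proposition1p6 (S : triangulatedCategory)
    (S_coproducts : has_coproducts S)
    (S_weakly_approximable : weakly_approximable S)
    (G : S) (G_generator : compact_generator G)
    (G_bounded_below : exists N : int,
      forall i : int, (i < N)%R -> hom_zero G (shift G i)) :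
  [/\ findim G <= maxe 0 (fpd G + approx_index G),
      fpd G <= findim G + oplus_bound G
    & findim G < +oo <-> fpd G < +oo].
Proof.
have [H [le0 [ge1 [A [Hgen tstr A0 H_le0 [Hleft Happrox]]]]]] :=
  S_weakly_approximable.
have [N GN] := G_bounded_below.
have [c0 Gc0] :=
  generator_hom_bounded S_coproducts Hgen tstr A0 H_le0 Hleft G_generator.
have [n Gn] := gen_le0_approximated
  S_coproducts Hgen tstr A0 H_le0 Hleft Happrox G_generator.
have [a aE Ga] := approx_index_fin S_coproducts Gn.
have [|c Gc cE] := @nat_infimum_fin
    [set c : nat | forall i : int, (c%:Z < i)%R -> hom_zero G (shift G i)].
  apply: (@le_lt_trans _ _ c0%:Z%:E); last exact: ltry.
  by apply: ge_infimum; exists c0.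
have findim_le (d : int) (m : nat) : fpd G <= d%:E -> (d + a%:Z <= m%:Z)%R ->
    findim G <= m%:Z%:E.
  move=> Gd dam; apply: ge_infimum; exists m => // X Xc Xge.
  have cX := is_compact_cpt Xc.
  apply: (cpt_small_gen S_coproducts G_generator GN Ga cX Xge _ dam).
  apply: le_trans Gd; apply: le_supremum; exists X; split=> //; split=> //.
  - exact: (cpt_gen_bounded S_coproducts G_generator).
  - exact/gen_ge0P.
  - exact: (cpt_pd_lt_oo S_coproducts G_generator Gc).
(* As [findim] is an infimum over naturals, a negative value of d + a only yields the bound 0. *)
have findim_bound : findim G <= maxe 0 (fpd G + approx_index G).
  rewrite aE le_max; case EG : (fpd G) => [d||].
  - case: (leP 0%R (d + a%:Z)%R) => da.
      apply/orP; right; rewrite -EFinD.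
      have <- : (absz (d + a%:Z)%R)%:Z = (d + a%:Z)%R by lia.
      by apply: (findim_le d); [rewrite EG|lia].
    by apply/orP; left; apply: (findim_le d 0%N); [rewrite EG|lia].
  - by rewrite addye // leey orbT.
  (* Here [fpd] is -oo, below every integer; - a is the one for which the bound becomes 0. *)
  - apply/orP; left; apply: (findim_le (- a%:Z)%R 0%N); last by lia.
    by rewrite EG leNye.
have fpd_bound : fpd G <= findim G + oplus_bound G.
  rewrite [oplus_bound G]cE.
  have [/nat_infimum_fin[m Gm mE]|] := ltP (findim G) +oo.
    by rewrite [findim G]mE -EFinD; apply: fpd_le.
  by rewrite leye_eq => /eqP ->; rewrite addye // leey.
split=> //; split=> [Gfin|].
  apply: le_lt_trans fpd_bound _; rewrite [oplus_bound G]cE.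
  exact: lte_add_pinfty Gfin (ltry _).
move=> Gfpd; apply: le_lt_trans findim_bound _; rewrite aE gt_max ltry.
exact: lte_add_pinfty Gfpd (ltry _).
Qed.
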